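(* Let $\operatorname{char}\mathbb{K}=p>0$, let $n\ge 2$ with $p\mid n$, suppose $\mathcal{E}_{gh}\ne 0$, and let $1\le j\le p-2$ and $d_j\ge d_{j-1}\ge\cdots\ge d_1\ge 1$ be integers. Then $\overline{\mathcal{T}}_n(p;d_j,d_{j-1},\ldots,d_1)=\overline{\mathcal{T}}_n(p)/(\mathcal{E}_{\omega_k}^{p^{d_k}}\mid 1\le k\le j)$ is an $\mathbb{N}$-graded pointed Hopf algebra.
   Context: $\mathbb{K}$ is a field, $\mathbb{N}=\{0,1,2,\ldots\}$, and $[a,b]=ab-ba$. On words in the letters $g,h$ use the lexicographic order with $g\prec h$ (a proper prefix of a word is smaller than the word). A Lyndon word is a nonempty word $\alpha$ which is a single letter or satisfies $\alpha\prec\gamma\beta$ for every factorization $\alpha=\beta\gamma$ into nonempty words. $\alpha(g)$ is the number of occurrences of $g$ in $\alpha$. The standard factorization of a Lyndon word $\alpha$ of length at least $2$ is $\alpha=\beta\gamma$ with $\beta,\gamma$ Lyndon and $\gamma$ of maximal length. Define $E_g=g$, $E_h=h$ and $E_\alpha=[E_\beta,E_\gamma]$ for the standard factorization $\alpha=\beta\gamma$. $\mathcal{T}=\mathbb{K}\langle g,h\rangle$ is the free algebra with bialgebra structure $\Delta(g)=g\otimes g$, $\Delta(h)=1\otimes h+h\otimes g$, $\epsilon(g)=1$, $\epsilon(h)=0$. $\overline{\mathcal{T}}=\mathcal{T}/\mathcal{I}$ is the quotient bialgebra by the ideal generated by all $E_\alpha$ with $\alpha$ Lyndon and $\alpha(g)\ge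 2$. For $k\ge 0$, $\omega_k=gh^k$, so $E_{\omega_0}=g$, $E_{\omega_1}=E_{gh}=[g,h]$, $E_{\omega_k}=[E_{\omega_{k-1}},h]$; $\mathcal{E}_{\omega_k}$ is the image of $E_{\omega_k}$ in a quotient, $\mathcal{E}_{gh}=\mathcal{E}_{\omega_1}$. $\overline{\mathcal{T}}_n=\overline{\mathcal{T}}/(g^n-1)$ (the hypothesis $\mathcal{E}_{gh}\neq0$ refers to $\overline{\mathcal{T}}_n$), $\overline{\mathcal{T}}_n'(p)=\overline{\mathcal{T}}_n/(\mathcal{E}_{\omega_{p-1}})$, $\overline{\mathcal{T}}_n(p)=\overline{\mathcal{T}}_n'(p)/(h^p)$; these are quotient Hopf algebras with the induced structure, as is meant for $\overline{\mathcal{T}}_n(p;d_j,\ldots,d_1)$. The grading is induced by $\deg g=0$, $\deg h=1$. A Hopf algebra is pointed if its coradical is spanned by grouplike elements. *)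

(* Defs.v *)
From HB Require Import structures.
From mathcomp Require Import all_boot all_order all_algebra.
From mathcomp Require Import finmap.
From mathcomp Require Import boolp classical_sets.
From mathcomp Require Import zify.
From mathcomp.multinomials Require Import monalg.

Set Implicit Arguments.
Unset Strict Implicit.
Unset Printing Implicit Defensive.

Import GRing.Theory Quotient.

Local Open Scope classical_set_scope.
Local Open Scope ring_scope.
Local Open Scope quotient_scope.

Reserved Notation "U ⊗ V" (at level 40, left associativity).

(* The algebras of MathComp ([lalgType], [algType]) are required to be nonzero,
   which would forbid quotients by arbitrary ideals. *)
Record pzAlgType (K : fieldType) := PzAlg {
  pz_base : lmodType K;
  pz_one : pz_base;
  pz_mul : pz_base -> pz_base -> pz_base;
  _ : associative pz_mul;
  _ : left_id pz_one pz_mul;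
  _ : right_id pz_one pz_mul;
  _ : forall y, linear (pz_mul^~ y);
  _ : forall x, linear (pz_mul x)
}.

Definition pz_sort (K : fieldType) (A : pzAlgType K) : Type := pz_base A.
Coercion pz_sort : pzAlgType >-> Sortclass.

Section PzAlgebra.
Variables (K : fieldType) (A : pzAlgType K).

HB.instance Definition _ := GRing.Lmodule.copy (pz_sort A) (pz_base A).

Fact pz_mulA : associative (@pz_mul K A). Proof. by case: A. Qed.
Fact pz_mul1 : left_id (pz_one A) (@pz_mul K A). Proof. by case: A. Qed.
Fact pz_mulr1 : right_id (pz_one A) (@pz_mul K A). Proof. by case: A. Qed.
Fact pz_mul_linearl y : linear ((@pz_mul K A)^~ y). Proof. by case: A y. Qed.
Fact pz_mul_linearr x : linear (@pz_mul K A x). Proof. by case: A x. Qed.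
Fact pz_mulDl : left_distributive (@pz_mul K A) +%R.
Proof. by move=> x y z; have := pz_mul_linearl z 1 x y; rewrite !scale1r. Qed.
Fact pz_mulDr : right_distributive (@pz_mul K A) +%R.
Proof. by move=> x y z; have := pz_mul_linearr x 1 y z; rewrite !scale1r. Qed.

HB.instance Definition _ := GRing.Zmodule_isPzRing.Build (pz_sort A)
  pz_mulA pz_mul1 pz_mulr1 pz_mulDl pz_mulDr.

Lemma pzscalerAl (a : K) (x y : A) : a *: (x * y) = (a *: x) * y.
Proof.
have := pz_mul_linearl y a x 0.
have -> : pz_mul 0 y = 0 by exact: (mul0r (y : A)).
by rewrite !addr0 => <-.
Qed.

Lemma pzscalerAr (a : K) (x y : A) : a *: (x * y) = x * (a *: y).
Proof.
have := pz_mul_linearr x a y 0.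
have -> : pz_mul x 0 = 0 by exact: (mulr0 (x : A)).
by rewrite !addr0 => <-.
Qed.

Lemma pzmulPl (a : K) (x y z : A) : (a *: x + y) * z = a *: (x * z) + y * z.
Proof. by rewrite mulrDl pzscalerAl. Qed.

Lemma pzmulPr (a : K) (x y z : A) : z * (a *: x + y) = a *: (z * x) + z * y.
Proof. by rewrite mulrDr pzscalerAr. Qed.

End PzAlgebra.
Coercion Defs_pz_sort__canonical__GRing_Lmodule :
  pzAlgType >-> GRing.Lmodule.type.

Notation "[ 'comm' x , y ]" := (x * y - y * x) : ring_scope.

Section Span.
Variables (K : fieldType) (V : lmodType K).

Definition subspace (W : set V) : Prop :=
  W 0 /\ forall (a : K) x y, W x -> W y -> W (a *: x + y).

Definition span (S : set V) : set V :=
  [set x | forall W, subspace W -> S `<=` W -> W x].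

Lemma span_subspace (S : set V) : subspace (span S).
Proof.
split=> [W [] //|a x y xS yS W Wsub SW].
by apply: (Wsub.2); [apply: xS | apply: yS].
Qed.

Lemma sub_span (S : set V) : S `<=` span S.
Proof. by move=> x Sx W _; apply. Qed.

Lemma span_min (S W : set V) : subspace W -> S `<=` W -> span S `<=` W.
Proof. by move=> Wsub SW x; apply. Qed.

Lemma span_id (W : set V) : subspace W -> span W = W.
Proof.
by move=> Wsub; apply/seteqP; split; [apply: span_min | apply: sub_span].
Qed.

Definition span_pred (S : set V) : {pred V} := fun x => `[< span S x >].

Lemma span_predP (S : set V) x : reflect (span S x) (x \in span_pred S).
Proof. exact: asboolP. Qed.

Lemma span_pred_submod (S : set V) : submod_closed (span_pred S).
Proof.
have [S0 SD] := span_subspace S.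
split=> [|a x y /span_predP xS /span_predP yS]; first exact/span_predP.
by apply/span_predP; apply: SD.
Qed.

HB.instance Definition _ (S : set V) :=
  GRing.isSubmodClosed.Build K V (span_pred S) (span_pred_submod S).

End Span.

Section IdealGen.
Variables (K : fieldType) (A : pzAlgType K).

Definition ideal (I : set A) : Prop :=
  subspace I /\ forall a x, I x -> I (a * x) /\ I (x * a).

Definition ideal_gen (S : set A) : set A :=
  [set x | forall I, ideal I -> S `<=` I -> I x].

Lemma ideal_gen_ideal (S : set A) : ideal (ideal_gen S).
Proof.
split; [split=> [I [[] //]|a x y xS yS I Iid SI] | move=> a x xS; split=> I Iid SI].
- by apply: (Iid.1.2); [apply: xS | apply: yS].
- by apply: (Iid.2 a x (xS I Iid SI)).1.
- by apply: (Iid.2 a x (xS I Iid SI)).2.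
Qed.

Lemma sub_ideal_gen (S : set A) : S `<=` ideal_gen S.
Proof. by move=> x Sx I _; apply. Qed.

End IdealGen.

Section QuotMod.
Variables (K : fieldType) (V : lmodType K) (S : set V).

Definition quotmod : Type := {quot (span_pred S)}.
HB.instance Definition _ := EqQuotient.on quotmod.
HB.instance Definition _ := GRing.Zmodule.on quotmod.

Definition qmod (x : V) : quotmod := \pi_quotmod x.

Lemma qmod_eq x y : (qmod x = qmod y) <-> span S (x - y).
Proof.
split=> [/eqP|Sxy]; last apply/eqP.
  by rewrite /qmod eqmodE => /span_predP.
by rewrite /qmod eqmodE; apply/span_predP.
Qed.

Lemma qmodK : cancel (@repr _ quotmod) qmod. Proof. exact: reprK. Qed.

Lemma qmodD x y : qmod (x + y) = qmod x + qmod y. Proof. exact: pi_add. Qed.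
Lemma qmodN x : qmod (- x) = - qmod x. Proof. exact: pi_opp. Qed.

Lemma qmod_eq0 x : (qmod x = 0) <-> span S x.
Proof.
have -> : 0 = qmod 0 by have := qmodD 0 0; rewrite addr0 => /esym/eqP; rewrite -subr_eq0 addrK => /eqP.
by rewrite qmod_eq subr0.
Qed.

Definition qscale (a : K) (x : quotmod) : quotmod := qmod (a *: repr x).

Lemma qscaleE a x : qscale a (qmod x) = qmod (a *: x).
Proof.
apply/qmod_eq; rewrite -scalerBr.
have [S0 SD] := span_subspace S; rewrite -[X in span S X]addr0; apply: SD => //.
by apply/qmod_eq; rewrite qmodK.
Qed.

Fact qscaleA a b x : qscale a (qscale b x) = qscale (a * b) x.
Proof. by rewrite -[x]qmodK !qscaleE scalerA. Qed.
Fact qscale1 : left_id 1 qscale.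
Proof. by move=> x; rewrite -[x]qmodK qscaleE scale1r. Qed.
Fact qscaleDr : right_distributive qscale +%R.
Proof.
by move=> a x y; rewrite -[x]qmodK -[y]qmodK -qmodD !qscaleE scalerDr qmodD.
Qed.
Fact qscaleDl x : {morph qscale^~ x : a b / a + b}.
Proof. by move=> a b /=; rewrite -[x]qmodK !qscaleE scalerDl qmodD. Qed.

HB.instance Definition _ :=
  GRing.Zmodule_isLmodule.Build K quotmod qscaleA qscale1 qscaleDr qscaleDl.

Fact qmod_linear : linear qmod.
Proof. by move=> a x y; rewrite qmodD -qscaleE. Qed.
HB.instance Definition _ := GRing.isLinear.Build K V quotmod *:%R qmod qmod_linear.

End QuotMod.

(* The quotient is used only through this interface; [quotient_alg] provides it
   and is opaque. *)
Record quotientAlg (K : fieldType) (A : pzAlgType K) (S : set A) := QuotientAlg {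
  quotient_carrier :> pzAlgType K;
  quotient_pi : A -> quotient_carrier;
  quotient_linear : linear quotient_pi;
  quotient_morph : monoid_morphism quotient_pi;
  quotient_surj : forall x, exists y, x = quotient_pi y;
  quotient_eq : forall x y,
    (quotient_pi x = quotient_pi y) <-> ideal_gen S (x - y)
}.

Section QuotAlgConstruction.
Variables (K : fieldType) (A : pzAlgType K) (S : set A).

Local Notation Q := (quotmod (ideal_gen S)).
Local Notation pi := (qmod (ideal_gen S)).

Definition qmul (x y : Q) : Q := pi ((repr x : A) * (repr y : A)).

Lemma qmod_ideal_eq (x y : A) : (pi x = pi y) <-> ideal_gen S (x - y).
Proof. by rewrite qmod_eq (span_id (ideal_gen_ideal S).1). Qed.

Lemma qmulE (x y : A) : qmul (pi x) (pi y) = pi (x * y).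
Proof.
have [Isub Imul] := ideal_gen_ideal S.
apply/qmod_ideal_eq; set x' : A := repr _; set y' : A := repr _.
have -> : x' * y' - x * y = 1 *: ((x' - x) * y') + x * (y' - y).
  by rewrite scale1r mulrBl mulrBr addrA subrK.
apply: Isub.2.
  by apply: (Imul _ _ _).2; apply/qmod_ideal_eq; rewrite qmodK.
by apply: (Imul _ _ _).1; apply/qmod_ideal_eq; rewrite qmodK.
Qed.

Fact qmulA : associative qmul.
Proof.
by move=> x y z; rewrite -[x]qmodK -[y]qmodK -[z]qmodK !qmulE mulrA.
Qed.
Fact qmul1 : left_id (pi (1 : A)) qmul.
Proof. by move=> x; rewrite -[x]qmodK qmulE mul1r. Qed.
Fact qmulr1 : right_id (pi (1 : A)) qmul.
Proof. by move=> x; rewrite -[x]qmodK qmulE mulr1. Qed.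
Fact qmul_linearl y : linear (qmul^~ y).
Proof.
move=> a x z; rewrite -[x]qmodK -[y]qmodK -[z]qmodK -linearP.
by rewrite !qmulE mulrDl -pzscalerAl linearP.
Qed.
Fact qmul_linearr x : linear (qmul x).
Proof.
move=> a y z; rewrite -[x]qmodK -[y]qmodK -[z]qmodK -linearP.
by rewrite !qmulE mulrDr -pzscalerAr linearP.
Qed.

Let quot_alg : pzAlgType K :=
  PzAlg qmulA qmul1 qmulr1 qmul_linearl qmul_linearr.
Let quot_pi (x : A) : quot_alg := pi x.

Let quot_pi_linear : linear quot_pi.
Proof. exact: (linearP pi). Qed.
Let quot_pi_morph : monoid_morphism quot_pi.
Proof. by split=> // x y; rewrite /quot_pi -qmulE. Qed.
Let quot_pi_eq x y : (quot_pi x = quot_pi y) <-> ideal_gen S (x - y).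
Proof. exact: qmod_ideal_eq. Qed.
Let quot_pi_surj (x : quot_alg) : exists y, x = quot_pi y.
Proof. by exists (repr (x : Q)); rewrite /quot_pi qmodK. Qed.

Lemma quotient_alg : quotientAlg S.
Proof.
exact: (QuotientAlg quot_pi_linear quot_pi_morph quot_pi_surj quot_pi_eq).
Qed.

End QuotAlgConstruction.

Section QuotAlg.
Variables (K : fieldType) (A : pzAlgType K) (S : set A).

Definition quotalg : pzAlgType K := quotient_alg S.
Definition qalg (x : A) : quotalg := quotient_pi (quotient_alg S) x.

Fact qalg_linear : linear qalg. Proof. exact: quotient_linear. Qed.
HB.instance Definition _ := GRing.isLinear.Build K A quotalg *:%R qalg qalg_linear.
Fact qalg_monoid_morphism : monoid_morphism qalg.
Proof. exact: quotient_morph. Qed.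
HB.instance Definition _ :=
  GRing.isMonoidMorphism.Build A quotalg qalg qalg_monoid_morphism.

Lemma qalg_surj (x : quotalg) : exists y, x = qalg y.
Proof. exact: quotient_surj. Qed.

Lemma qalg_eq x y : (qalg x = qalg y) <-> ideal_gen S (x - y).
Proof. exact: quotient_eq. Qed.

Lemma qalg_eq0 x : (qalg x = 0) <-> ideal_gen S x.
Proof. by rewrite -[0](linear0 qalg) qalg_eq subr0. Qed.

End QuotAlg.

Section FreeMod.
Variables (K : fieldType) (X : choiceType) (W : lmodType K).

Definition malg_lift (f : X -> W) (x : {malg K[X]}) : W :=
  \sum_(k <- msupp x) x@_k *: f k.

Lemma malg_liftw (f : X -> W) (d : {fset X}) (x : {malg K[X]}) :
  (msupp x `<=` d)%fset -> malg_lift f x = \sum_(k <- d) x@_k *: f k.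
Proof.
move=> le_d; apply: big_fset_incl => // k _ /mcoeff_outdom ->.
by rewrite scale0r.
Qed.

Fact malg_lift_linear f : linear (malg_lift f).
Proof.
move=> a x y; pose d := (msupp (a *: x + y) `|` (msupp x `|` msupp y))%fset.
rewrite (@malg_liftw f d (a *: x + y)) ?fsubsetUl //.
rewrite (@malg_liftw f d x); last first.
  by rewrite fsubsetU // fsubsetUl orbT.
rewrite (@malg_liftw f d y); last first.
  by rewrite fsubsetU // fsubsetUr orbT.
rewrite scaler_sumr -big_split /=; apply: eq_bigr => k _.
by rewrite mcoeffD mcoeffZ scalerDl scalerA.
Qed.
HB.instance Definition _ f :=
  GRing.isLinear.Build K {malg K[X]} W *:%R (malg_lift f) (malg_lift_linear f).

Lemma malg_liftE f k : malg_lift f << k >> = f k.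
Proof. by rewrite /malg_lift msuppU oner_eq0 big_seq_fset1 mcoeffUU scale1r. Qed.

Lemma malg_lift_funP a f g x :
  malg_lift (fun k => a *: f k + g k) x = a *: malg_lift f x + malg_lift g x.
Proof.
rewrite /malg_lift scaler_sumr -big_split /=; apply: eq_bigr => k _.
by rewrite scalerDr !scalerA mulrC.
Qed.

Lemma malg_span (x : {malg K[X]}) : span [set (<< k >> : {malg K[X]}) | k in [set: X]] x.
Proof.
have [S0 SD] := span_subspace [set (<< k >> : {malg K[X]}) | k in [set: X]].
rewrite [x]monalgE; elim/big_ind: _ => // [u v Su Sv|k _].
  by rewrite -[u]scale1r; apply: SD.
have -> : << x@_k *g k >> = x@_k *: << k >> + 0 :> {malg K[X]}.
  by apply/malgP=> l; rewrite addr0 mcoeffZ !mcoeffU mulr_natr.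
by apply: SD => //; apply: sub_span; exists k.
Qed.

End FreeMod.

Definition bilinear_map (K : fieldType) (U V W : lmodType K)
    (f : U -> V -> W) : Prop :=
  (forall v, linear (f^~ v)) /\ (forall u, linear (f u)).

(* The tensor product is used only through this interface; [tensor_product]
   provides it and is opaque. *)
Record tensorProduct (K : fieldType) (U V : lmodType K) := TensorProduct {
  tensor_carrier :> lmodType K;
  tensor_pure : U -> V -> tensor_carrier;
  tensor_lift : forall W : lmodType K, (U -> V -> W) -> tensor_carrier -> W;
  tensor_bilinear : bilinear_map tensor_pure;
  tensor_span : forall t, span [set x | exists u v, x = tensor_pure u v] t;
  tensor_lift_linear : forall (W : lmodType K) (f : U -> V -> W),
    bilinear_map f -> linear (tensor_lift f);
  tensor_liftE : forall (W : lmodType K) (f : U -> V -> W),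
    bilinear_map f -> forall u v, tensor_lift f (tensor_pure u v) = f u v
}.

Section TensorConstruction.
Variables (K : fieldType) (U V : lmodType K).

Definition bilinear_rel : set {malg K[(U * V)%type]} :=
  [set t | exists (a : K) (u u' : U) (v : V),
     t = << (a *: u + u', v) >> - (a *: << (u, v) >> + << (u', v) >>)] `|`
  [set t | exists (a : K) (u : U) (v v' : V),
     t = << (u, a *: v + v') >> - (a *: << (u, v) >> + << (u, v') >>)].

Let T : lmodType K := quotmod bilinear_rel.
Let pure (u : U) (v : V) : T := qmod bilinear_rel << (u, v) >>.

Let pure_bilinear : bilinear_map pure.
Proof.
split=> [v|u] a x y; rewrite -[RHS](linearP (qmod bilinear_rel)).
  by apply/qmod_eq; apply: sub_span; left; exists a, x, y, v.
by apply/qmod_eq; apply: sub_span; right; exists a, u, x, y.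
Qed.

Let pure_span (t : T) : span [set x | exists u v, x = pure u v] t.
Proof.
rewrite -[t]qmodK.
pose W := [set x | span [set x | exists u v, x = pure u v] (qmod bilinear_rel x)].
have [S0 SD] := span_subspace [set x | exists u v, x = pure u v].
suff : W (repr t) by [].
apply: (malg_span (repr t)) => [|_ [[u v] _ <-]].
  split=> [|a x y Wx Wy]; first by rewrite /W /= linear0.
  by rewrite /W /= linearP; apply: SD.
by apply: sub_span; exists u, v.
Qed.

Let lift (W : lmodType K) (f : U -> V -> W) (t : T) : W :=
  malg_lift (fun p => f p.1 p.2) (repr t).

Let lift_pi (W : lmodType K) (f : U -> V -> W) : bilinear_map f -> forall x,
  lift f (qmod _ x) = malg_lift (fun p => f p.1 p.2) x.
Proof.
move=> [fl fr] x; apply/eqP; rewrite -subr_eq0 -raddfB /=; apply/eqP.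
set y := _ - _; have: span bilinear_rel y.
  by apply/qmod_eq; rewrite qmodK.
apply: (@span_min _ _ _ [set y | malg_lift (fun p => f p.1 p.2) y = 0]).
  split=> [|a u v /= u0 v0]; first exact: linear0.
  by rewrite linearP /= u0 v0 scaler0 addr0.
move=> _ [[a [u [u' [v ->]]]]|[a [u [v [v' ->]]]]] /=.
  by rewrite linearB linearP /= !malg_liftE /= fl subrr.
by rewrite linearB linearP /= !malg_liftE /= fr subrr.
Qed.

Let lift_linear (W : lmodType K) (f : U -> V -> W) :
  bilinear_map f -> linear (lift f).
Proof.
move=> bf a x y; rewrite -[x]qmodK -[y]qmodK.
rewrite -[X in lift f X](linearP (qmod _)).
by rewrite !lift_pi // linearP.
Qed.

Let lift_pure (W : lmodType K) (f : U -> V -> W) :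
  bilinear_map f -> forall u v, lift f (pure u v) = f u v.
Proof. by move=> bf u v; rewrite lift_pi // malg_liftE. Qed.

Lemma tensor_product : tensorProduct U V.
Proof.
exact: (TensorProduct pure_bilinear pure_span lift_linear lift_pure).
Qed.

End TensorConstruction.

Section Tensor.
Variables (K : fieldType) (U V : lmodType K).

Definition tensor : Type := tensor_product U V.
HB.instance Definition _ := GRing.Lmodule.copy tensor (tensor_product U V).

Definition tens (u : U) (v : V) : tensor := tensor_pure (tensor_product U V) u v.

Lemma tens_linearl v : linear (tens^~ v).
Proof. exact: (tensor_bilinear (tensor_product U V)).1. Qed.
Lemma tens_linearr u : linear (tens u).
Proof. exact: (tensor_bilinear (tensor_product U V)).2. Qed.
HB.instance Definition _ u :=
  GRing.isLinear.Build K V tensor *:%R (tens u) (tens_linearr u).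

Lemma tens_span (t : tensor) : span [set x | exists u v, x = tens u v] t.
Proof. exact: tensor_span. Qed.

End Tensor.

Notation "U ⊗ V" := (tensor U V) : type_scope.
Notation "u ⊗ v" := (tens u v) : ring_scope.

Section TensorLift.
Variables (K : fieldType) (U V W : lmodType K).

(* Meaningful only when f is bilinear. *)
Definition tens_lift (f : U -> V -> W) (t : (U ⊗ V)%type) : W :=
  @tensor_lift K U V (tensor_product U V) W f t.

Lemma tens_lift_linear f : bilinear_map f -> linear (tens_lift f).
Proof. exact: tensor_lift_linear. Qed.

Lemma tens_liftE f : bilinear_map f -> forall u v, tens_lift f (u ⊗ v) = f u v.
Proof. exact: tensor_liftE. Qed.

Lemma tens_ext (f g : (U ⊗ V)%type -> W) : linear f -> linear g ->
  (forall u v, f (u ⊗ v) = g (u ⊗ v)) -> f =1 g.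
Proof.
move=> lf lg fg t.
apply: (tens_span t (W := [set t | f t = g t])) => [|_ [u [v ->]]]; last exact: fg.
split=> [|a x y /= fgx fgy]; last by rewrite lf lg fgx fgy.
have zero h : linear h -> h (0 : (U ⊗ V)%type) = 0 :> W.
  move=> lh; have := lh 1 0 0; rewrite !scale1r addr0 => /esym/eqP.
  by rewrite -subr_eq0 addrK => /eqP.
by rewrite /= !zero.
Qed.

Lemma tens_lift_funP a f g : bilinear_map f -> bilinear_map g ->
  forall t, tens_lift (fun u v => a *: f u v + g u v) t =
    a *: tens_lift f t + tens_lift g t.
Proof.
have comb k (x y z w : W) :
    a *: (k *: x + y) + (k *: z + w) = k *: (a *: x + z) + (a *: y + w).
  by rewrite !scalerDr !scalerA addrACA mulrC.
move=> bf bg; have bfg : bilinear_map (fun u v => a *: f u v + g u v).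
  by split=> [v|u] k x y; rewrite ?bf.1 ?bf.2 ?bg.1 ?bg.2 comb.
apply: tens_ext => [|k x y|u v]; first exact: tens_lift_linear.
  by rewrite !(tens_lift_linear bf) !(tens_lift_linear bg) comb.
by rewrite !tens_liftE.
Qed.

End TensorLift.

Section TensorMap.
Variables (K : fieldType) (U V U' V' : lmodType K).

Definition tens_map (f : U -> U') (g : V -> V') : (U ⊗ V -> U' ⊗ V')%type :=
  tens_lift (fun u v => f u ⊗ g v).

Lemma tens_map_bilinear f g : linear f -> linear g ->
  bilinear_map (fun (u : U) (v : V) => (f u : U') ⊗ (g v : V')).
Proof.
by move=> lf lg; split=> [v|u] a x y; rewrite ?lf ?lg ?tens_linearl ?tens_linearr.
Qed.

Lemma tens_mapE (f : {linear U -> U'}) (g : {linear V -> V'}) u v :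
  tens_map f g (u ⊗ v) = f u ⊗ g v.
Proof. by apply: tens_liftE; apply: tens_map_bilinear; apply: linearP. Qed.

Fact tens_map_linear (f : {linear U -> U'}) (g : {linear V -> V'}) :
  linear (tens_map f g).
Proof. by apply: tens_lift_linear; apply: tens_map_bilinear; apply: linearP. Qed.
HB.instance Definition _ (f : {linear U -> U'}) (g : {linear V -> V'}) :=
  GRing.isLinear.Build K _ _ *:%R (tens_map f g) (tens_map_linear f g).

End TensorMap.

Section TensorCanonical.
Variables (K : fieldType) (U V W : lmodType K).

Definition tens_assoc : (U ⊗ V ⊗ W -> U ⊗ (V ⊗ W))%type :=
  tens_lift (fun t w => tens_lift (fun u v => u ⊗ (v ⊗ w)) t).

Lemma tens_assoc_bilinear1 (w : W) :
  bilinear_map (fun (u : U) (v : V) => u ⊗ (v ⊗ w)).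
Proof.
split=> [v|u] a x y; first by rewrite tens_linearl.
by rewrite tens_linearl tens_linearr.
Qed.

Lemma tens_assoc_bilinear2 : bilinear_map
  (fun (t : (U ⊗ V)%type) (w : W) => tens_lift (fun u v => u ⊗ (v ⊗ w)) t).
Proof.
split=> [w|t]; first by apply: tens_lift_linear; apply: tens_assoc_bilinear1.
move=> a x y.
rewrite -(tens_lift_funP a (tens_assoc_bilinear1 x) (tens_assoc_bilinear1 y)).
congr (tens_lift _ t).
by apply/funext => u; apply/funext => v; rewrite !tens_linearr.
Qed.

Lemma tens_assocE u v w : tens_assoc (u ⊗ v ⊗ w) = u ⊗ (v ⊗ w).
Proof.
rewrite /tens_assoc tens_liftE; last exact: tens_assoc_bilinear2.
by rewrite tens_liftE //; apply: tens_assoc_bilinear1.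
Qed.

Fact tens_assoc_linear : linear tens_assoc.
Proof. exact/tens_lift_linear/tens_assoc_bilinear2. Qed.
HB.instance Definition _ :=
  GRing.isLinear.Build K _ _ *:%R tens_assoc tens_assoc_linear.

Definition tens_lunit : (K^o ⊗ V -> V)%type := 
  tens_lift (fun (a : K^o) (v : V) => (a : K) *: v).
Definition tens_runit : (V ⊗ K^o -> V)%type := 
  tens_lift (fun (v : V) (a : K^o) => (a : K) *: v).

Lemma tens_lunit_bilinear : 
  bilinear_map (fun (a : K^o) (v : V) => (a : K) *: v).
Proof.
split=> [v|u] a x y; first by rewrite scalerDl scalerA.
by rewrite scalerDr !scalerA mulrC.
Qed.
Lemma tens_runit_bilinear : 
  bilinear_map (fun (v : V) (a : K^o) => (a : K) *: v).
Proof.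
split=> [v|u] a x y; last by rewrite scalerDl scalerA.
by rewrite scalerDr !scalerA mulrC.
Qed.
Lemma tens_lunitE (a : K^o) v : tens_lunit (a ⊗ v) = a *: v.
Proof. exact: (tens_liftE tens_lunit_bilinear). Qed.
Lemma tens_runitE (a : K^o) v : tens_runit (v ⊗ a) = a *: v.
Proof. exact: (tens_liftE tens_runit_bilinear). Qed.
Fact tens_lunit_linear : linear tens_lunit.
Proof. exact/tens_lift_linear/tens_lunit_bilinear. Qed.
Fact tens_runit_linear : linear tens_runit.
Proof. exact/tens_lift_linear/tens_runit_bilinear. Qed.
HB.instance Definition _ :=
  GRing.isLinear.Build K _ _ *:%R tens_lunit tens_lunit_linear.
HB.instance Definition _ :=
  GRing.isLinear.Build K _ _ *:%R tens_runit tens_runit_linear.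

End TensorCanonical.

Section TensorAlgebra.
Variables (K : fieldType) (A B : pzAlgType K).
Local Notation AB := (A ⊗ B)%type.

Definition tens_one : AB := (1 : A) ⊗ (1 : B).
Definition tens_mul (s t : AB) : AB :=
  tens_lift (fun (a : A) (b : B) => tens_lift (fun (c : A) (d : B) => (a * c) ⊗ (b * d)) t) s.

Lemma tens_mul_bilinear1 (a : A) (b : B) :
  bilinear_map (fun (c : A) (d : B) => (a * c) ⊗ (b * d)).
Proof.
split=> [d|c] k x y.
  by rewrite mulrDr -pzscalerAr tens_linearl.
by rewrite mulrDr -pzscalerAr tens_linearr.
Qed.

Lemma tens_mul_bilinear2 (t : AB) : bilinear_map
  (fun (a : A) (b : B) => tens_lift (fun (c : A) (d : B) => (a * c) ⊗ (b * d)) t).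
Proof.
have lf := tens_mul_bilinear1.
split=> [b|a] k x y.
  rewrite -(tens_lift_funP k (lf x b) (lf y b)); congr (tens_lift _ t).
  by apply/funext => c; apply/funext => d; rewrite pzmulPl tens_linearl.
rewrite -(tens_lift_funP k (lf a x) (lf a y)); congr (tens_lift _ t).
by apply/funext => c; apply/funext => d; rewrite pzmulPl tens_linearr.
Qed.

Lemma tens_mulE (a c : A) (b d : B) : tens_mul (a ⊗ b) (c ⊗ d) = (a * c) ⊗ (b * d).
Proof.
by rewrite /tens_mul (tens_liftE (tens_mul_bilinear2 _))
  (tens_liftE (tens_mul_bilinear1 _ _)).
Qed.

Fact tens_mul_linearl t : linear (tens_mul^~ t).
Proof. exact/tens_lift_linear/tens_mul_bilinear2. Qed.

Fact tens_mul_linearr s : linear (tens_mul s).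
Proof.
move=> k x y; have lf := tens_mul_bilinear2.
rewrite /tens_mul -(tens_lift_funP k (lf x) (lf y)); congr (tens_lift _ s).
apply/funext => a; apply/funext => b.
exact: (tens_lift_linear (tens_mul_bilinear1 a b)).
Qed.

Fact tens_mul1 : left_id tens_one tens_mul.
Proof.
apply: (tens_ext (tens_mul_linearr _)) => // a b.
by rewrite tens_mulE !mul1r.
Qed.
Fact tens_mulr1 : right_id tens_one tens_mul.
Proof.
apply: (tens_ext (tens_mul_linearl _)) => // a b.
by rewrite tens_mulE !mulr1.
Qed.
Fact tens_mulA : associative tens_mul.
Proof.
move=> x y z; move: x; apply: tens_ext => [k x x'|k x x'|a b].
- by rewrite !tens_mul_linearl.
- by rewrite !tens_mul_linearl.
move: y; apply: tens_ext => [k x x'|k x x'|c d].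
- by rewrite tens_mul_linearl !tens_mul_linearr.
- by rewrite tens_mul_linearr !tens_mul_linearl.
move: z; apply: tens_ext => [k x x'|k x x'|e f].
- by rewrite !tens_mul_linearr.
- by rewrite !tens_mul_linearr.
by rewrite !tens_mulE !mulrA.
Qed.

Definition tens_alg : pzAlgType K :=
  PzAlg tens_mulA tens_mul1 tens_mulr1 tens_mul_linearl tens_mul_linearr.

Lemma tensM (a c : A) (b d : B) : (a ⊗ b : tens_alg) * (c ⊗ d) = (a * c) ⊗ (b * d).
Proof. exact: tens_mulE. Qed.

Lemma tens1 : 1 = (1 : A) ⊗ (1 : B) :> tens_alg. Proof. by []. Qed.

End TensorAlgebra.

Section MulMap.
Variables (K : fieldType) (A : pzAlgType K).

Definition mul_map : (A ⊗ A -> A)%type := tens_lift (fun (a b : A) => a * b).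

Lemma mul_map_bilinear : bilinear_map (fun a b : A => a * b).
Proof.
split=> [b|a] k x y; first by rewrite mulrDl pzscalerAl.
by rewrite mulrDr pzscalerAr.
Qed.
Lemma mul_mapE (a b : A) : mul_map (a ⊗ b) = a * b.
Proof. exact: (tens_liftE mul_map_bilinear). Qed.
Fact mul_map_linear : linear mul_map.
Proof. exact/tens_lift_linear/mul_map_bilinear. Qed.
HB.instance Definition _ := GRing.isLinear.Build K _ _ *:%R mul_map mul_map_linear.

End MulMap.

Lemma tens_map_monoid_morphism (K : fieldType) (A B A' B' : pzAlgType K)
    (f : {linear A -> A'}) (g : {linear B -> B'}) :
  monoid_morphism f -> monoid_morphism g ->
  monoid_morphism (tens_map f g : tens_alg A B -> tens_alg A' B').
Proof.
move=> [f1 fM] [g1 gM]; split; first by rewrite tens1 tens_mapE f1 g1.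
move=> x y; move: x; apply: tens_ext => [k x x'|k x x'|a b].
- by rewrite pzmulPl linearP.
- by rewrite linearP pzmulPl.
move: y; apply: tens_ext => [k x x'|k x x'|c d].
- by rewrite pzmulPr linearP.
- by rewrite linearP pzmulPr.
by rewrite tensM !tens_mapE tensM fM gM.
Qed.

Lemma tens_assoc_monoid_morphism (K : fieldType) (A B C : pzAlgType K) :
  monoid_morphism (@tens_assoc K A B C :
    tens_alg (tens_alg A B) C -> tens_alg A (tens_alg B C)).
Proof.
split; first exact: tens_assocE.
move=> x y; move: x; apply: tens_ext => [k x x'|k x x'|s e].
- by rewrite pzmulPl linearP.
- by rewrite linearP pzmulPl.
move: s; apply: tens_ext => [k x x'|k x x'|a b].
- by rewrite tens_linearl pzmulPl linearP.
- by rewrite tens_linearl linearP pzmulPl.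
move: y; apply: tens_ext => [k x x'|k x x'|t f].
- by rewrite pzmulPr linearP.
- by rewrite linearP pzmulPr.
move: t; apply: tens_ext => [k x x'|k x x'|c d].
- by rewrite tens_linearl pzmulPr linearP.
- by rewrite tens_linearl linearP pzmulPr.
by rewrite !tens_assocE !tensM tens_assocE.
Qed.

Section Hopf.
Variable K : fieldType.

Record coalgebra (C : lmodType K) := Coalgebra {
  comul : {linear C -> (C ⊗ C)%type};
  counit : {linear C -> K^o};
  comul_assoc : forall x,
    tens_assoc (tens_map comul idfun (comul x)) =
    tens_map idfun comul (comul x);
  counit_left : forall x, tens_lunit (tens_map counit idfun (comul x)) = x;
  counit_right : forall x, tens_runit (tens_map idfun counit (comul x)) = x
}.

Record bialgebra (A : pzAlgType K) := Bialgebra {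
  coalgebra_of_bialgebra :> coalgebra A;
  comul_morph :
    monoid_morphism (comul coalgebra_of_bialgebra : A -> tens_alg A A);
  counit_morph : monoid_morphism (counit coalgebra_of_bialgebra : A -> K)
}.

Record hopf_algebra (A : pzAlgType K) := HopfAlgebra {
  bialgebra_of_hopf_algebra :> bialgebra A;
  antipode : {linear A -> A};
  antipode_left : forall x,
    mul_map (tens_map antipode idfun (comul bialgebra_of_hopf_algebra x)) =
    (counit bialgebra_of_hopf_algebra x : K) *: (1 : A);
  antipode_right : forall x,
    mul_map (tens_map idfun antipode (comul bialgebra_of_hopf_algebra x)) =
    (counit bialgebra_of_hopf_algebra x : K) *: (1 : A)
}.

Definition bialgebra_morphism (A B : pzAlgType K) (bA : bialgebra A)
    (bB : bialgebra B) (f : {linear A -> B}) : Prop :=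
  [/\ monoid_morphism f,
      forall x, comul bB (f x) = tens_map f f (comul bA x) &
      forall x, counit bB (f x) = counit bA x].

(* The image of X ⊗ Y in U ⊗ V, when X and Y are subspaces. *)
Definition tens_sub (U V : lmodType K) (X : set U) (Y : set V) :
    set (U ⊗ V)%type :=
  span [set t | exists u v, [/\ X u, Y v & t = u ⊗ v]].

Section Pointed.
Variables (C : lmodType K) (H : coalgebra C).

Definition subcoalgebra (D : set C) : Prop :=
  subspace D /\ forall x, D x -> tens_sub D D (comul H x).

Definition simple_subcoalgebra (D : set C) : Prop :=
  [/\ subcoalgebra D, D <> [set 0] &
      forall D', subcoalgebra D' -> D' `<=` D -> D' = [set 0] \/ D' = D].

Definition coradical : set C :=
  span [set x | exists2 D, simple_subcoalgebra D & D x].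

Definition grouplike (x : C) : Prop :=
  comul H x = x ⊗ x /\ counit H x = 1.

Definition pointed : Prop := coradical = span grouplike.

End Pointed.

Definition direct_sum_decomposition (V : lmodType K) (G : nat -> set V) : Prop :=
  [/\ forall i, subspace (G i),
      forall x, exists m (f : nat -> V),
        (forall i, G i (f i)) /\ x = \sum_(i < m) f i &
      forall m (f : nat -> V), (forall i, G i (f i)) ->
        \sum_(i < m) f i = 0 -> forall i, (i < m)%N -> f i = 0].

Record graded_hopf_algebra (A : pzAlgType K) (H : hopf_algebra A)
    (G : nat -> set A) : Prop := {
  graded_sum : direct_sum_decomposition G;
  graded_one : G 0 1;
  graded_mul : forall i j x y, G i x -> G j y -> G (i + j)%N (x * y);
  graded_comul : forall n x, G n x ->
    span (\bigcup_(i in [set i | (i <= n)%N]) tens_sub (G i) (G (n - i)%N))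
      (comul H x);
  graded_counit : forall n x, (0 < n)%N -> G n x -> counit H x = 0;
  graded_antipode : forall n x, G n x -> G n (antipode H x)
}.

End Hopf.

(* The letters g and h; the order on [bool] is [false < true]. *)
Definition lg : bool := false.
Definition lh : bool := true.

Definition word := seq bool.

Definition lyndon (w : word) : bool :=
  (w != [::]) &&
  all (fun i => ((w : seqlexi bool) < (drop i w ++ take i w : word))%O)
    (iota 1 (size w).-1).

(* For a Lyndon word of length at least 2, the length of the left factor of the
   standard factorization; the default 1 is then not used. *)
Definition std_cut (w : word) : nat :=
  head 1%N [seq i <- iota 1 (size w).-1 |
    lyndon (take i w) && lyndon (drop i w)].

Definition standard_factorization (b c : word) : Prop :=
  [/\ lyndon b, lyndon c &
      forall b' c', lyndon b' -> lyndon c' -> b' ++ c' = b ++ c ->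
        (size c' <= size c)%N].

Lemma std_cutE b c : standard_factorization b c -> std_cut (b ++ c) = size b.
Proof.
move=> [Lb Lc cmax]; rewrite /std_cut.
have b0 : (0 < size b)%N by case: (b) Lb.
have c0 : (0 < size c)%N by case: (c) Lc.
set P := fun i => _ && _.
have Pb : P (size b) by rewrite /P take_size_cat // drop_size_cat // Lb.
have szE : (size (b ++ c)).-1 = ((size b).-1 + (size c).-1.+1)%N.
  by rewrite size_cat; case: (size b) (size c) b0 c0 => [|m] // [|n].
rewrite szE iotaD filter_cat /= add1n prednK // Pb.
rewrite (_ : [seq i <- _ | P i] = [::]) //.
apply/eqP; rewrite -(negbK (_ == _)) -has_filter -all_predC.
apply/allP => i; rewrite mem_iota add1n prednK // => /andP[i1 ib] /=.
apply/negP => /andP[L1 L2].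
have := cmax _ _ L1 L2 (cat_take_drop i _).
by rewrite size_drop size_cat leqNgt => /negP; apply; lia.
Qed.

Definition omega (k : nat) : word := lg :: nseq k lh.

(* The vector space with basis the words, multiplied by concatenation; it is
   used only through this interface, which the opaque [free_algebra] provides. *)
Record freeAlgebra (K : fieldType) := FreeAlgebra {
  free_carrier :> pzAlgType K;
  free_word : word -> free_carrier;
  free_word0 : free_word [::] = 1;
  free_wordM : forall u v, free_word (u ++ v) = free_word u * free_word v;
  free_span : forall x, span [set free_word w | w in [set: word]] x;
  free_lin : forall W : lmodType K, (word -> W) -> free_carrier -> W;
  free_lin_linear : forall (W : lmodType K) (f : word -> W), linear (free_lin f);
  free_linE : forall (W : lmodType K) (f : word -> W) w,
    free_lin f (free_word w) = f w
}.

Section FreeAlgebraConstruction.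
Variable K : fieldType.

Local Notation M := {malg K[fmonom bool]}.

Let malg_mul_linearl (y : M) : linear (fun x : M => x * y).
Proof. by move=> a x z; rewrite mulrDl scalerAl. Qed.
Let malg_mul_linearr (x : M) : linear (fun y : M => x * y).
Proof.
move=> a y z; rewrite mulrDr; congr (_ + _).
have xC : x * a%:MP = a%:MP * x.
  rewrite !malgM_def fgmulgU fgmulUg; apply: eq_bigr => k _.
  by rewrite mulrC mulm1 mul1m.
by rewrite -(mul_malgC a y) -(mul_malgC a (x * y)) mulrA xC mulrA.
Qed.

Let T : pzAlgType K :=
  @PzAlg K M 1 *%R (@mulrA M) (@mul1r M) (@mulr1 M)
    malg_mul_linearl malg_mul_linearr.

Let mon (w : word) : T := << FMonom w >> : M.

Let mon0 : mon [::] = 1.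
Proof. by rewrite /mon -fmoneE. Qed.

Let monM u v : mon (u ++ v) = mon u * mon v.
Proof.
rewrite [RHS](_ : _ = (<< FMonom u >> * << FMonom v >> : M)) //.
rewrite malgM_def fgmulUU mulr1; congr << _ >>.
by apply/eqP; rewrite fmP fmM.
Qed.

Let mon_span (x : T) : span [set mon w | w in [set: word]] x.
Proof.
apply: (malg_span (x : M) (W := span [set mon w | w in [set: word]])).
  exact: span_subspace.
move=> _ [w _ <-]; apply: sub_span; exists (w : seq bool) => //.
by rewrite /mon fmK.
Qed.

Let lin (W : lmodType K) (f : word -> W) : T -> W :=
  malg_lift (fun w : fmonom bool => f w).

Let lin_linear (W : lmodType K) (f : word -> W) : linear (lin f).
Proof. exact: malg_lift_linear. Qed.

Let linE (W : lmodType K) (f : word -> W) w : lin f (mon w) = f w.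
Proof. exact: malg_liftE. Qed.

Lemma free_algebra : freeAlgebra K.
Proof. exact: (FreeAlgebra mon0 monM mon_span lin_linear linE). Qed.

End FreeAlgebraConstruction.

Section FreeAlgebra.
Variable K : fieldType.

Definition free_alg : pzAlgType K := free_algebra K.
Local Notation T := free_alg.

Definition monomial (w : word) : T := free_word (free_algebra K) w.

Lemma monomial0 : monomial [::] = 1.
Proof. exact: free_word0. Qed.

Lemma monomialM u v : monomial (u ++ v) = monomial u * monomial v.
Proof. exact: free_wordM. Qed.

Lemma monomial_span (x : T) : span [set monomial w | w in [set: word]] x.
Proof. exact: free_span. Qed.

Section FreeLift.
Variables (A : pzAlgType K) (f : bool -> A).

Definition free_lift : T -> A :=
  @free_lin K (free_algebra K) A (fun w => \prod_(x <- w) f x).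

Fact free_lift_linear : linear free_lift.
Proof. exact: free_lin_linear. Qed.
HB.instance Definition _ :=
  GRing.isLinear.Build K T A *:%R free_lift free_lift_linear.

Lemma free_liftE w : free_lift (monomial w) = \prod_(x <- w) f x.
Proof. exact: free_linE. Qed.

Fact free_lift_monoid_morphism : monoid_morphism free_lift.
Proof.
split=> [|x y]; first by rewrite -monomial0 free_liftE big_nil.
pose Wx := [set x | forall y, free_lift (x * y) = free_lift x * free_lift y].
move: y; apply: (monomial_span x (W := Wx)) => {x} [|_ [u _ <-] y].
  split=> [y|a x x' Wx0 Wx1 y]; first by rewrite mul0r !linear0 mul0r.
  by rewrite pzmulPl !linearP pzmulPl /= Wx0 Wx1.
pose Wy := [set y | free_lift (monomial u * y) =
                    free_lift (monomial u) * free_lift y].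
apply: (monomial_span y (W := Wy)) => {y} [|_ [v _ <-]].
  split=> [|a x x' Wx0 Wx1]; first by rewrite /Wy /= mulr0 !linear0 mulr0.
  by rewrite /Wy /= pzmulPr !linearP pzmulPr /= Wx0 Wx1.
by rewrite /Wy /= -monomialM !free_liftE big_cat.
Qed.
HB.instance Definition _ :=
  GRing.isMonoidMorphism.Build T A free_lift free_lift_monoid_morphism.

End FreeLift.

Lemma free_ext (A : pzAlgType K) (f f' : T -> A) :
  linear f -> monoid_morphism f -> linear f' -> monoid_morphism f' ->
  (forall x, f (monomial [:: x]) = f' (monomial [:: x])) -> f =1 f'.
Proof.
move=> lf [f1 fM] lf' [f1' fM'] ff' x.
have zero (h : T -> A) : linear h -> h 0 = 0.
  move=> lh; have := lh 1 0 0; rewrite !scale1r addr0 => /esym/eqP.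
  by rewrite -subr_eq0 addrK => /eqP.
apply: (monomial_span x (W := [set x | f x = f' x])) => {x} [|_ [w _ <-]] /=.
  split=> [|a x y /= fx fy]; first by rewrite /= !zero.
  by rewrite lf lf' fx fy.
elim: w => [|c w IHw]; first by rewrite monomial0 f1 f1'.
by rewrite -cat1s monomialM fM fM' ff' IHw.
Qed.

Definition gT : T := monomial [:: lg].
Definition hT : T := monomial [:: lh].

Fact scalar_mul_linearl (y : K^o) : linear (fun x : K^o => x * y).
Proof. by move=> a x z; rewrite mulrDl scalerAl. Qed.
Fact scalar_mul_linearr (x : K^o) : linear (fun y : K^o => x * y).
Proof. by move=> a y z; rewrite mulrDr scalerAr. Qed.

Definition scalar_alg : pzAlgType K :=
  @PzAlg K K^o 1 *%R (@mulrA K) (@mul1r K) (@mulr1 K)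
    scalar_mul_linearl scalar_mul_linearr.

Definition free_comul : T -> (T ⊗ T)%type :=
  @free_lift (tens_alg T T)
    (fun x => if x == lg then gT ⊗ gT else (1 : T) ⊗ hT + hT ⊗ gT).
Definition free_counit : T -> K^o :=
  @free_lift scalar_alg (fun x => if x == lg then 1 else 0).

Fact free_comul_linear : linear free_comul.
Proof. exact: (@free_lift_linear (tens_alg T T)). Qed.
HB.instance Definition _ :=
  GRing.isLinear.Build K T _ *:%R free_comul free_comul_linear.
Fact free_comul_morph :
  monoid_morphism (free_comul : T -> tens_alg T T).
Proof. exact: free_lift_monoid_morphism. Qed.
Fact free_counit_linear : linear free_counit.
Proof. exact: (@free_lift_linear scalar_alg). Qed.
HB.instance Definition _ :=
  GRing.isLinear.Build K T K^o *:%R free_counit free_counit_linear.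
Fact free_counit_morph : monoid_morphism (free_counit : T -> K).
Proof. exact: (@free_lift_monoid_morphism scalar_alg). Qed.

Lemma free_comul_g : free_comul gT = gT ⊗ gT.
Proof. by rewrite /free_comul free_liftE big_seq1. Qed.
Lemma free_comul_h : free_comul hT = (1 : T) ⊗ hT + hT ⊗ gT.
Proof. by rewrite /free_comul free_liftE big_seq1. Qed.
Lemma free_counit_g : free_counit gT = 1.
Proof. by rewrite /free_counit free_liftE big_seq1. Qed.
Lemma free_counit_h : free_counit hT = 0.
Proof. by rewrite /free_counit free_liftE big_seq1. Qed.
Lemma free_comul1 : free_comul 1 = (1 : T) ⊗ (1 : T).
Proof. exact: free_comul_morph.1. Qed.
Lemma free_counit1 : free_counit 1 = 1.
Proof. exact: free_counit_morph.1. Qed.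

Lemma monoid_morphism_comp (A B C : pzAlgType K) (f : B -> C) (f' : A -> B) :
  monoid_morphism f -> monoid_morphism f' -> monoid_morphism (f \o f').
Proof.
by move=> [f1 fM] [f1' fM']; split=> [|x y] /=; rewrite ?f1' ?f1 ?fM' ?fM.
Qed.

Fact id_monoid_morphism (A : pzAlgType K) : monoid_morphism (@idfun A).
Proof. by []. Qed.

Fact tens_lunit_morph (A : pzAlgType K) :
  monoid_morphism (@tens_lunit K A : tens_alg scalar_alg A -> A).
Proof.
split=> [|x y]; first by rewrite tens1 tens_lunitE scale1r.
move: x; apply: tens_ext => [k x x'|k x x'|a b].
- by rewrite pzmulPl linearP.
- by rewrite linearP pzmulPl.
move: y; apply: tens_ext => [k x x'|k x x'|c d].
- by rewrite pzmulPr linearP.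
- by rewrite linearP pzmulPr.
rewrite (@tensM K scalar_alg A) !tens_lunitE.
by rewrite -pzscalerAl -pzscalerAr scalerA.
Qed.

Fact tens_runit_morph (A : pzAlgType K) :
  monoid_morphism (@tens_runit K A : tens_alg A scalar_alg -> A).
Proof.
split=> [|x y]; first by rewrite tens1 tens_runitE scale1r.
move: x; apply: tens_ext => [k x x'|k x x'|a b].
- by rewrite pzmulPl linearP.
- by rewrite linearP pzmulPl.
move: y; apply: tens_ext => [k x x'|k x x'|c d].
- by rewrite pzmulPr linearP.
- by rewrite linearP pzmulPr.
rewrite (@tensM K A scalar_alg) !tens_runitE.
by rewrite -pzscalerAl -pzscalerAr scalerA.
Qed.

Fact free_comul_assoc x :
  tens_assoc (tens_map free_comul idfun (free_comul x)) =
  tens_map idfun free_comul (free_comul x).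
Proof.
have D := free_comul_morph; have I := id_monoid_morphism T.
move: x; apply: (@free_ext (tens_alg T (tens_alg T T))
  (fun x => tens_assoc (tens_map free_comul idfun (free_comul x)))
  (fun x => tens_map idfun free_comul (free_comul x))).
- by move=> k x y; rewrite !linearP.
- apply: (monoid_morphism_comp (@tens_assoc_monoid_morphism K T T T)).
  apply: (monoid_morphism_comp _ D).
  exact: (@tens_map_monoid_morphism K T T (tens_alg T T) T free_comul idfun).
- by move=> k x y; rewrite !linearP.
- apply: (monoid_morphism_comp _ D).
  exact: (@tens_map_monoid_morphism K T T T (tens_alg T T) idfun free_comul).
case; rewrite -/gT -/hT.
  rewrite free_comul_h !linearD /= !tens_mapE /= free_comul_h free_comul_g free_comul1.
  have add (y : T) : {morph (fun x : (T ⊗ T)%type => x ⊗ y) : a b / a + b}.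
    by move=> a b; have := tens_linearl y 1 a b; rewrite !scale1r.
  by rewrite add !linearD /= !tens_assocE addrA.
by rewrite free_comul_g !tens_mapE /= free_comul_g tens_assocE.
Qed.

Fact free_counit_left x : tens_lunit (tens_map free_counit idfun (free_comul x)) = x.
Proof.
move: x; apply: (@free_ext T
  (fun x => tens_lunit (tens_map free_counit idfun (free_comul x))) idfun) => //.
- by move=> k x y; rewrite !linearP.
- apply: (monoid_morphism_comp (@tens_lunit_morph T)).
  apply: (monoid_morphism_comp _ free_comul_morph).
  apply: (@tens_map_monoid_morphism K T T scalar_alg T free_counit idfun) => //.
  exact: free_counit_morph.
case; rewrite -/gT -/hT.
  rewrite free_comul_h !linearD /= !tens_mapE /= free_counit_h free_counit1.
  by rewrite !tens_lunitE scale1r scale0r addr0.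
by rewrite free_comul_g tens_mapE /= free_counit_g tens_lunitE scale1r.
Qed.

Fact free_counit_right x : tens_runit (tens_map idfun free_counit (free_comul x)) = x.
Proof.
move: x; apply: (@free_ext T
  (fun x => tens_runit (tens_map idfun free_counit (free_comul x))) idfun) => //.
- by move=> k x y; rewrite !linearP.
- apply: (monoid_morphism_comp (@tens_runit_morph T)).
  apply: (monoid_morphism_comp _ free_comul_morph).
  apply: (@tens_map_monoid_morphism K T T T scalar_alg idfun free_counit) => //.
  exact: free_counit_morph.
case; rewrite -/gT -/hT.
  rewrite free_comul_h !linearD /= !tens_mapE /= free_counit_h free_counit_g.
  by rewrite !tens_runitE scale1r scale0r add0r.
by rewrite free_comul_g tens_mapE /= free_counit_g tens_runitE scale1r.
Qed.

Definition free_bialgebra : bialgebra T :=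
  @Bialgebra K T
    (@Coalgebra K T free_comul free_counit
      free_comul_assoc free_counit_left free_counit_right)
    free_comul_morph free_counit_morph.

End FreeAlgebra.

Section Quotients.
Variable K : fieldType.
Local Notation T := (free_alg K).

(* E_α for α of length at most m. *)
Fixpoint E_rec (m : nat) (w : word) : T :=
  if m is m'.+1 then
    if (size w <= 1)%N then monomial K w
    else let i := std_cut w in
      [comm E_rec m' (take i w), E_rec m' (drop i w)]
  else 0.

Definition E (w : word) : T := E_rec (size w) w.

Lemma E_letter (x : bool) : E [:: x] = monomial K [:: x].
Proof. by []. Qed.

Lemma std_cut_bounds w : (1 < size w)%N -> (0 < std_cut w < size w)%N.
Proof.
rewrite /std_cut => w1; case sE: [seq i <- _ | _] => [|i s] //=.
have : i \in [seq i <- iota 1 (size w).-1 |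
  lyndon (take i w) && lyndon (drop i w)] by rewrite sE mem_head.
by rewrite mem_filter mem_iota => /andP[_]; lia.
Qed.

Lemma E_recE m w : (0 < size w <= m)%N -> E_rec m w = E w.
Proof.
rewrite /E; elim/ltn_ind: m w => m IHm w /andP[w0 wm].
case: m => [|m] in IHm wm *; first by move: w0 wm; lia.
case sw: (size w) w0 => [|s] // _ /=; rewrite sw; case: ltnP => // s0.
have := @std_cut_bounds w; rewrite sw => /(_ s0) /andP[c0 cs].
have st : size (take (std_cut w) w) = std_cut w by rewrite size_takel // sw ltnW.
have sd : size (drop (std_cut w) w) = (s.+1 - std_cut w)%N by rewrite size_drop sw.
by rewrite !(IHm m) ?[in RHS](IHm s) ?st ?sd //; lia.
Qed.

Lemma E_bracket b c : standard_factorization b c ->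
  E (b ++ c) = [comm E b, E c].
Proof.
move=> bc; have cutE := std_cutE bc; case: bc => Lb Lc _.
have b0 : (0 < size b)%N by case: (b) Lb.
have c0 : (0 < size c)%N by case: (c) Lc.
rewrite {1}/E; case sE: (size (b ++ c)) => [|m]; first by rewrite size_cat in sE; lia.
rewrite /= cutE take_size_cat // drop_size_cat // sE.
rewrite size_cat in sE; case: ltnP => [|_]; first by lia.
by rewrite !E_recE //; lia.
Qed.

Definition Tbar : pzAlgType K :=
  @quotalg K T [set E w | w in [set w | lyndon w && (2 <= count_mem lg w)%N]].
Definition Tbar_pi : T -> Tbar := @qalg K T _.

Definition Tbar_n (n : nat) : pzAlgType K :=
  @quotalg K Tbar [set Tbar_pi (gT K) ^+ n - 1].
Definition Tbar_n_pi (n : nat) : T -> Tbar_n n := @qalg K Tbar _ \o Tbar_pi.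

Definition Tbar_n_p' (n p : nat) : pzAlgType K :=
  @quotalg K (Tbar_n n) [set Tbar_n_pi n (E (omega p.-1))].
Definition Tbar_n_p'_pi (n p : nat) : T -> Tbar_n_p' n p :=
  @qalg K (Tbar_n n) _ \o @Tbar_n_pi n.

Definition Tbar_n_p (n p : nat) : pzAlgType K :=
  @quotalg K (Tbar_n_p' n p) [set Tbar_n_p'_pi n p (hT K) ^+ p].
Definition Tbar_n_p_pi (n p : nat) : T -> Tbar_n_p n p :=
  @qalg K (Tbar_n_p' n p) _ \o @Tbar_n_p'_pi n p.

(* The values d k with k = 0 or j < k are not used. *)
Definition Tbar_n_p_d (n p j : nat) (d : nat -> nat) : pzAlgType K :=
  @quotalg K (Tbar_n_p n p)
    [set Tbar_n_p_pi n p (E (omega k)) ^+ (p ^ d k) |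
      k in [set k | (1 <= k <= j)%N]].
Definition Tbar_n_p_d_pi (n p j : nat) (d : nat -> nat) :
    T -> Tbar_n_p_d n p j d :=
  @qalg K (Tbar_n_p n p) _ \o @Tbar_n_p_pi n p.

HB.instance Definition _ := GRing.Linear.on Tbar_pi.
HB.instance Definition _ := GRing.RMorphism.on Tbar_pi.
HB.instance Definition _ n := GRing.Linear.on (Tbar_n_pi n).
HB.instance Definition _ n := GRing.RMorphism.on (Tbar_n_pi n).
HB.instance Definition _ n p := GRing.Linear.on (Tbar_n_p'_pi n p).
HB.instance Definition _ n p := GRing.RMorphism.on (Tbar_n_p'_pi n p).
HB.instance Definition _ n p := GRing.Linear.on (Tbar_n_p_pi n p).
HB.instance Definition _ n p := GRing.RMorphism.on (Tbar_n_p_pi n p).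
HB.instance Definition _ n p j d := GRing.Linear.on (Tbar_n_p_d_pi n p j d).
HB.instance Definition _ n p j d :=
  GRing.RMorphism.on (Tbar_n_p_d_pi n p j d).

Definition free_degree (m : nat) : set T :=
  span [set monomial K w | w in [set w | count_mem lh w = m]].

Definition Tbar_n_p_d_degree (n p j : nat) (d : nat -> nat) (m : nat) :
    set (Tbar_n_p_d n p j d) :=
  Tbar_n_p_d_pi n p j d @` free_degree m.

End Quotients.

(* Main.v *)
Require Import Defs.
From HB Require Import structures.
From mathcomp Require Import all_boot all_order all_algebra.
From mathcomp Require Import boolp classical_sets.
From mathcomp Require Import zify.
(* Imported last so that span and subspace denote subsets of a module. *)
Require Import Defs.

(** Write x_k for the element E of the word g h^k, so that x_0 = g and
    x_(k+1) = [x_k, h], and π for the projection of the free algebra T onto the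
    quotient A of the theorem.

    Presentation. If a < b then g h^a g h^b is a Lyndon word with standard
    factorization (g h^a)(g h^b), so E of it is [x_a, x_b]. Conversely, once the x_k
    commute, E of every word with two or more letters g vanishes. Hence A is
    presented by g and h subject to: the x_k commute pairwise, g^n = 1, x_(p-1) = 0,
    h^p = 0, and x_k^(p^d_k) = 0 for 1 <= k <= j ([Tbar_lift], [Tbar_relations]).
    Algebra maps out of A are therefore given by pairs of elements that satisfy
    these relations.

    Comultiplication. The pair to test is (g ⊗ g, 1 ⊗ h + h ⊗ g) in A ⊗ A. By
    induction Δ(x_k) is g ⊗ x_k plus a sum of terms x_i ⊗ q with 1 <= i <= k and q
    in the commutative algebra generated by the x's ([comul_ad_pow]). So the Δ(x_k)
    commute, and their p-powers are computed termwise; the power relations follow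
    because d_i <= d_k for i <= k. The relations h^p = 0 and x_(p-1) = 0 rest on a
    case of Jacobson's formula: in characteristic p,
      (h + a)^p = h^p + a^p + [...[a, h], ..., h]    (p - 1 brackets)
    if a commutes with its iterated brackets by h ([jacobson]). It computes the p-th
    powers of 1 ⊗ h + h ⊗ g and of 1 ⊗ h + (h + g) ⊗ g; as the latter is
    Δ(h) + Δ(g), the formula for h + a with h = Δ(h), a = Δ(g) gives the iterated
    bracket ([comul_relations]).

    Antipode. There is an anti-morphism s from T to A with s(g) = g^-1 and
    s(h) = -h g^-1, and it is convolution inverse to π. It descends to A: up to
    any given degree in h it can be rewritten as a map that factors through π,
    because the algebra map with g ↦ g^-1, h ↦ 0 already inverts the identity of A
    in degree 0 ([antipode_bounded]).

    Grading. The pair (g ⊗ 1, h ⊗ X) in A ⊗ K[X] satisfies the relations, and the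
    resulting coaction separates the degrees ([Tbar_coaction]).

    Pointedness. Degree 0 is spanned by the powers of g, which are grouplike. In a
    graded coalgebra every simple subcoalgebra lies in degree 0
    ([simple_sub_degree0]), and each grouplike element spans a simple subcoalgebra. *)

Set Implicit Arguments.
Unset Strict Implicit.
Unset Printing Implicit Defensive.

Import GRing.Theory Order.Theory.

Local Open Scope classical_set_scope.
Local Open Scope ring_scope.

(** * A case of Jacobson's formula *)

Definition ad_pow (R : pzRingType) (b : R) (k : nat) (a : R) : R :=
  iter k (fun x => [comm x, b]) a.

Lemma ad_powS (R : pzRingType) (b : R) k a :
  ad_pow b k.+1 a = [comm ad_pow b k a, b].
Proof. by []. Qed.

Section Jacobson.
Variables (R : nzRingType) (p : nat).
Hypothesis charR : p \in [pchar R].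

Let p_pr : prime p. Proof. exact: pcharf_prime charR. Qed.

Lemma ad_pow_expand (y a : R) m :
  ad_pow y m a = \sum_(i < m.+1) (-1) ^+ i *+ 'C(m, i) * y ^+ i * a * y ^+ (m - i).
Proof.
elim: m => [|m IH]; first by rewrite big_ord1 /= !mul1r mulr1.
rewrite ad_powS IH mulr_suml mulr_sumr.
rewrite big_ord_recl [in RHS]big_ord_recl [in RHS]big_ord_recr /= !bin0 !subn0.
rewrite -!mulrA -exprSr -addrA; congr (_ + _).
rewrite [X in _ - X]big_ord_recr /= !subnn !binn opprD addrA; congr (_ + _); last first.
  rewrite !expr0 !mulr1 !mulr1n exprS mulN1r !mulNr exprS -!mulrA.
  congr (- _); rewrite !mulrA; congr (_ * _ ).
  by congr (_ * _); apply: commr_sign.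
rewrite -sumrB; apply: eq_bigr => i _; rewrite /bump /= !add1n subSS binS mulrnDr.
rewrite !mulrDl; congr (_ + _); first by rewrite -!mulrA -exprSr subnSK.
rewrite (exprS (-1)) mulN1r mulNrn !mulNr; congr (- _).
rewrite exprS !mulrA; congr (_ * _ * _); congr (_ * _).
by rewrite mulrnAr mulrnAl; congr (_ *+ _); apply: commr_sign.
Qed.

(** Pascal's rule and p dividing the middle binomials of row p force the signs
    of row p - 1 to alternate. *)
Lemma pchar_signed_bin i : (i < p)%N -> (-1) ^+ i *+ 'C(p.-1, i) = 1 :> R.
Proof.
elim: i => [|i IH] ip; first by rewrite bin0.
have := IH (ltnW ip); have p0 := prime_gt0 p_pr.
have : ('C(p, i.+1))%:R = 0 :> R.
  by apply/eqP; rewrite -(dvdn_pcharf charR) prime_dvd_bin.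
rewrite -{1}(prednK p0) binS natrD => /eqP; rewrite addr_eq0 => /eqP e IHi.
by rewrite exprS mulN1r mulNrn -mulr_natr e mulrN opprK mulr_natr IHi // ltnW.
Qed.

(** In terms of the commuting operators of left and right multiplication by y
    this is (R - L)^(p-1) = sum of the L^i R^(p-1-i); its right-hand side is what
    differentiating a p-th power produces. *)
Lemma pchar_ad_pow (y a : R) :
  ad_pow y p.-1 a = \sum_(i < p) y ^+ i * a * y ^+ (p.-1 - i).
Proof.
rewrite ad_pow_expand (prednK (prime_gt0 p_pr)).
by apply: eq_bigr => i _; rewrite pchar_signed_bin // mul1r.
Qed.

End Jacobson.

Lemma derivX_noncomm (R : nzRingType) (q : {poly R}) m :
  (q ^+ m)^`() = \sum_(i < m) q ^+ i * q^`() * q ^+ (m.-1 - i).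
Proof.
elim: m => [|m IH]; first by rewrite big_ord0 expr0 derivC.
rewrite exprSr derivM IH big_ord_recr /= subnn mulr1 mulr_suml; congr (_ + _).
apply: eq_bigr => i _; rewrite -!mulrA -exprSr; congr (_ * (_ * _ ^+ _)).
by case: m i {IH} => [[]//|m] i /=; rewrite subSn // -ltnS.
Qed.

Lemma lead_linear_exp (R : nzRingType) (h a : R) m :
  (forall i, (m < i)%N -> ((h%:P + a%:P * 'X) ^+ m)`_i = 0)
  /\ ((h%:P + a%:P * 'X) ^+ m)`_m = a ^+ m.
Proof.
elim: m => [|m [IH1 IH2]]; first by split=> [[]// i _|]; rewrite expr0 coef1.
split=> [[//|i] mi|]; rewrite exprSr mulrDr coefD coefMC mulrA coefMX /= coefMC.
  by rewrite !IH1 ?mul0r ?addr0 // (leq_trans _ mi).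
by rewrite (IH1 m.+1) // mul0r add0r IH2 exprSr.
Qed.

Lemma pchar_mulrn_eq0 (R : nzRingType) p (x : R) i : p \in [pchar R] ->
  (0 < i < p)%N -> x *+ i = 0 -> x = 0.
Proof.
move=> charR /andP[i0 ip] xi; have p_pr := pcharf_prime charR.
have [u _] := @Bezoutl i p i0.
have -> : gcdn i p = 1%N.
  apply/eqP; rewrite -/(coprime i p) coprime_sym prime_coprime //.
  by apply/negP => /(dvdn_leq i0); rewrite leqNgt ip.
case/dvdnP=> k /(congr1 (fun m => x *+ m)); rewrite mulrnDr mulr1n.
rewrite mulrnA -mulr_natr (pcharf0 charR) mulr0 addr0 => ->.
by rewrite mulnC mulrnA xi mul0rn.
Qed.

(** Let Y = h + aX, with X a central variable. The derivative of Y^p is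
    ad_Y^(p-1)(a), which is ad_h^(p-1)(a) because a commutes with its own iterated
    brackets. This is a constant, so Y^p has no term of degree 2, ..., p - 1, and
    its terms of degree 0, 1 and p are h^p, ad_h^(p-1)(a) X and a^p X^p. The formula
    is the value at X = 1. *)
Lemma jacobson_nz (R : nzRingType) (p : nat) (h a : R) : p \in [pchar R] ->
  (forall k, GRing.comm (ad_pow h k a) a) ->
  (h + a) ^+ p = h ^+ p + a ^+ p + ad_pow h p.-1 a.
Proof.
move=> charR ca; have p_pr := pcharf_prime charR.
pose Y : {poly R} := h%:P + a%:P * 'X.
have adY k : ad_pow Y k a%:P = (ad_pow h k a)%:P.
  elim: k => // k IH; rewrite ad_powS IH /Y mulrDr mulrDl opprD addrACA.
  rewrite -!polyCM mulrA -polyCM -mulrA -commr_polyX mulrA -polyCM (ca k) subrr addr0.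
  by rewrite -polyCB.
have dY : Y^`() = a%:P by rewrite derivD derivC derivM derivX derivC mul0r !add0r mulr1.
have charY : p \in [pchar {poly R}] by rewrite pchar_poly.
have dYp : (Y ^+ p)^`() = (ad_pow h p.-1 a)%:P.
  by rewrite derivX_noncomm dY -adY (pchar_ad_pow charY).
have p1 := prime_gt1 p_pr.
have c1 : (Y ^+ p)`_1 = ad_pow h p.-1 a.
  by have := coef_deriv (Y ^+ p) 0; rewrite dYp coefC /= mulr1n.
have c0 : (Y ^+ p)`_0 = h ^+ p.
  have cY0 : comm_poly Y 0 by rewrite /comm_poly mulr0 mul0r.
  by rewrite -horner_coef0 horner_exp_comm // /Y hornerD hornerC hornerMX mulr0 addr0.
have [cgt cp] := lead_linear_exp h a p; rewrite -/Y in cgt cp.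
have cmid i : (1 < i < p)%N -> (Y ^+ p)`_i = 0.
  case: i => [|[|i]] // /andP[_ ip]; apply: (@pchar_mulrn_eq0 _ _ _ i.+2 charR) => //.
  by rewrite -coef_deriv dYp coefC.
have cY1 : comm_poly Y 1 by rewrite /comm_poly mulr1 mul1r.
have -> : h + a = Y.[1] by rewrite /Y hornerD hornerC hornerMX hornerC mulr1.
rewrite -horner_exp_comm // (@horner_coef_wide _ p.+1); last exact/leq_sizeP.
have -> : p.+1 = (p.-2.+1.+1.+1) by case: (p) p1 => [|[]].
rewrite big_ord_recl big_ord_recl big_ord_recr /= big1 => [|i _].
  rewrite !expr1n !mulr1 add0r /bump /= !add1n.
  have -> : p.-2.+2 = p by case: (p) p1 => [|[]].
  by rewrite c0 c1 cp (addrC (ad_pow _ _ _)) addrA.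
rewrite /bump /= !add1n cmid ?mul0r //=.
by case: (p) p1 i => [|[]] // m _ [i /=].
Qed.

(** The special case of Jacobson's formula for (h + a)^p in which all Lie terms
    of degree at least 2 in a vanish. *)
Lemma jacobson (R : pzRingType) (p : nat) (h a : R) : prime p -> p%:R = 0 :> R ->
  (forall k, GRing.comm (ad_pow h k a) a) ->
  (h + a) ^+ p = h ^+ p + a ^+ p + ad_pow h p.-1 a.
Proof.
move=> p_pr pR0 ca.
(* The zero ring is set apart, as polynomials are taken over nonzero rings. *)
have [R0|R1] := eqVneq (1 : R) 0.
  have z (x : R) : x = 0 by rewrite -[x]mul1r R0 mul0r.
  by rewrite [LHS]z [RHS]z.
pose NZ := GRing.PzSemiRing_isNonZero.Build R R1.
pose R' : nzRingType := HB.pack (R : Type) (GRing.PzRing.class R) NZ.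
apply: (@jacobson_nz R' p h a) => //.
by rewrite inE p_pr; apply/eqP.
Qed.

(** * Lyndon words with at most two letters g *)

Lemma lt_letter_words (v w : word) :
  ((lg :: v : seqlexi bool) < (lh :: w : word))%O.
Proof. by rewrite Order.SeqLexiOrder.ltxi_cons. Qed.

Lemma lyndon_rot_gt w i : lyndon w -> (0 < i < size w)%N ->
  ((w : seqlexi bool) < (drop i w ++ take i w : word))%O.
Proof.
move=> /andP[_ /allP Lw] iw; apply: Lw.
by rewrite mem_iota; case: (size w) iw => [|s] /=; lia.
Qed.

Lemma rot_lh_gt (v : word) i : (i < size (lg :: v))%N ->
  nth lg (lg :: v) i = lh ->
  ((lg :: v : seqlexi bool) < (drop i (lg :: v) ++ take i (lg :: v) : word))%O.
Proof. by move=> iv ilh; rewrite (drop_nth lg) // ilh lt_letter_words. Qed.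

(** Rotating a Lyndon word to begin at a letter g would decrease it, so a Lyndon
    word can begin with h only if it contains no g; then it equals its rotations. *)
Lemma lyndon_lh (v : word) : lyndon (lh :: v) -> v = [::].
Proof.
case: v => // x v Lw; exfalso; have [gv|gv] := boolP (lg \in x :: v).
  set i := index lg (x :: v).
  have ix : (i < size (x :: v))%N by rewrite index_mem.
  have := @lyndon_rot_gt _ i.+1 Lw; rewrite -(cat1s lh (x :: v)) size_cat ltnS.
  by move=> /(_ ix); rewrite drop_cat ltnNge /= subSS subn0 (drop_nth lg ix) nth_index.
have vE : x :: v = nseq (size (x :: v)) lh.
  apply/all_pred1P/allP => y yv /=; apply/eqP.
  by case: y yv => // yv; case: (negP gv yv).
have := @lyndon_rot_gt _ 1 Lw isT.
have -> : drop 1 [:: lh, x & v] ++ take 1 [:: lh, x & v] = [:: lh, x & v].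
  by rewrite vE /= ?drop0 ?take0 -[[:: lh]]/(nseq 1 lh) -nseqD addn1.
by rewrite ltxx.
Qed.

Lemma lyndon_omega k : lyndon (omega k).
Proof.
apply/allP => i; rewrite mem_iota /= size_nseq add1n ltnS => /andP[i0 ik].
apply: rot_lh_gt; first by rewrite /= size_nseq.
by case: i i0 ik => // i _ ik; rewrite /= nth_nseq ik.
Qed.

Lemma nseq_lh_lt a b (u v : word) : (a < b)%N ->
  ((nseq a lh ++ lg :: u : seqlexi bool) < (nseq b lh ++ v : word))%O.
Proof.
elim: a b => [|a IH] [|b] // ab.
by rewrite /= Order.SeqLexiOrder.ltxi_cons /= IH.
Qed.

Lemma lyndon_omega_cat a b : (a < b)%N -> lyndon (omega a ++ omega b).
Proof.
move=> ab; apply/allP => i; rewrite mem_iota => /andP[i0 iw].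
have sw : size (omega a ++ omega b) = (a + b).+2.
  by rewrite size_cat /= !size_nseq addSn addnS.
rewrite sw /= add1n ltnS in iw.
have [ia|ia] := eqVneq i a.+1.
  rewrite ia drop_size_cat ?take_size_cat /= ?size_nseq //.
  by rewrite Order.SeqLexiOrder.ltxi_cons lexx /= nseq_lh_lt.
apply: rot_lh_gt; first by rewrite -[lg :: _]/(omega a ++ omega b) sw; lia.
rewrite -[lg :: _]/(omega a ++ omega b) nth_cat /= size_nseq.
case: i i0 iw ia => // i _ iw ia; case: ltnP => ai /=.
  by rewrite nth_nseq -ltnS ai.
have -> : (i.+1 - a.+1 = (i - a.+1).+1)%N by lia.
by rewrite /= nth_nseq; case: ltnP => //; lia.
Qed.

(** A right factor longer than c begins inside the block h^a of the left factor,
    hence with an h, and the only Lyndon word beginning with h is h itself. *)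
Lemma omega_standard_factorization a c : lyndon c ->
  standard_factorization (omega a) c.
Proof.
move=> Lc; split=> // [|b' c' Lb' Lc' e]; first exact: lyndon_omega.
have c0 : (0 < size c)%N by case: (c) Lc.
have b0 : (0 < size b')%N by case: (b') Lb'.
have sc : (size b' + size c' = a.+1 + size c)%N.
  by rewrite -size_cat e size_cat /= size_nseq.
have [ab|ab] := leqP (size b') a; last by lia.
have := congr1 (fun w => nth lg w (size b')) e.
rewrite !nth_cat ltnn subnn (_ : size (omega a) = a.+1) ?ltnS ?ab;
  last by rewrite /= size_nseq.
case: (size b') b0 ab => // i _ ia; rewrite /= nth_nseq ia.
case: c' Lc' {e sc} => // x v Lx /= xE; rewrite xE in Lx.
by rewrite (lyndon_lh Lx).
Qed.

Section RelationWords.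
Variable K : fieldType.

Lemma E_omegaS k : E K (omega k.+1) = [comm E K (omega k), hT K].
Proof.
rewrite -(E_bracket K (@omega_standard_factorization k [:: lh] isT)).
by rewrite /omega cat_cons -[[:: lh]]/(nseq 1 lh) -nseqD addn1.
Qed.

Lemma E_omega k : E K (omega k) = ad_pow (hT K) k (gT K).
Proof. by elim: k => // k IH; rewrite E_omegaS IH. Qed.

Lemma E_omega_cat a b :
  E K (omega a ++ omega b) = [comm E K (omega a), E K (omega b)].
Proof.
by apply/E_bracket/omega_standard_factorization/lyndon_omega.
Qed.

End RelationWords.

(** * Presentation of the quotient *)

Section Descent.
Variable K : fieldType.

Lemma linear_pack (U V : lmodType K) (f : U -> V) : linear f ->
  exists F : {linear U -> V}, F =1 f.
Proof.
move=> lf; pose M := GRing.isLinear.Build K U V *:%R f lf.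
by exists (HB.pack_for {linear U -> V} f M).
Qed.

Lemma linear_descend (U V W : lmodType K) (q : {linear U -> V})
    (f : {linear U -> W}) :
  (forall y, exists x, y = q x) -> (forall x, q x = 0 -> f x = 0) ->
  exists F : {linear V -> W}, forall x, F (q x) = f x.
Proof.
move=> q_surj ker_qf; have [r rE] := choice q_surj.
have Fq x : f (r (q x)) = f x.
  by apply/eqP; rewrite -subr_eq0 -linearB ker_qf // linearB /= -rE subrr.
have [|F FE] := @linear_pack V W (f \o r).
  by move=> a x y; rewrite /= [in LHS](rE x) [in LHS](rE y) -linearP Fq linearP.
by exists F => x; rewrite FE /= Fq.
Qed.

Lemma morphism_descend (A B C : pzAlgType K) (q : A -> B) (f : A -> C) (F : B -> C) :
  (forall y, exists x, y = q x) -> monoid_morphism q -> monoid_morphism f ->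
  (forall x, F (q x) = f x) -> monoid_morphism F.
Proof.
move=> q_surj [q1 qM] [f1 fM] Fq; split=> [|x y]; first by rewrite -q1 Fq.
have [[x' ->] [y' ->]] := (q_surj x, q_surj y).
by rewrite -qM !Fq fM.
Qed.

Lemma quotalg_lift (A B : pzAlgType K) (S : set A) (f : {linear A -> B}) :
  monoid_morphism f -> (forall x, S x -> f x = 0) ->
  exists F : {linear quotalg S -> B},
    monoid_morphism F /\ forall x, F (qalg S x) = f x.
Proof.
move=> fM fS; have [|x /qalg_eq0|F FE] := @linear_descend _ _ _ (@qalg K A S) f.
- exact: qalg_surj.
- move=> Ix; apply: (Ix [set y | f y = 0]) => //; split.
    by split=> [|a u v /= fu fv]; rewrite /= ?linear0 // linearP fu fv scaler0 addr0.
  by move=> a u /= fu; rewrite !fM.2 fu mulr0 mul0r.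
exists F; split=> //; apply: morphism_descend fM FE; first exact: qalg_surj.
exact: qalg_monoid_morphism.
Qed.

Lemma morph_ad_pow (A B : pzAlgType K) (f : {linear A -> B}) b k a :
  monoid_morphism f -> f (ad_pow b k a) = ad_pow (f b) k (f a).
Proof.
move=> fM; elim: k => // k IH.
by rewrite !ad_powS linearB /= !fM.2 IH.
Qed.

Lemma morph_exp (A B : pzSemiRingType) (f : A -> B) k a :
  monoid_morphism f -> f (a ^+ k) = f a ^+ k.
Proof.
by move=> [f1 fM]; elim: k => [|k IH]; rewrite ?expr0 // !exprS fM IH.
Qed.

End Descent.

Section UniversalProperty.
Variables (K : fieldType) (n p j : nat) (d : nat -> nat).
Local Notation T := (free_alg K).
Local Notation A := (Tbar_n_p_d K n p j d).
Local Notation pi := (@Tbar_n_p_d_pi K n p j d).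

Definition pairwise_comm (B : pzRingType) (a b : B) : Prop :=
  forall i k, GRing.comm (ad_pow b i a) (ad_pow b k a).

(** The defining relations of the quotient, with the relations E_α = 0 for
    α(g) >= 2 replaced by the commutation of the iterated brackets of g by h. *)
Record relations (B : pzRingType) (a b : B) : Prop := Relations {
  rel_comm : pairwise_comm a b;
  rel_g : a ^+ n = 1;
  rel_omega : ad_pow b p.-1 a = 0;
  rel_h : b ^+ p = 0;
  rel_pow : forall k, (1 <= k <= j)%N -> ad_pow b k a ^+ (p ^ d k) = 0
}.

Lemma span_comm (B : pzAlgType K) (S : set B) x y :
  (forall u v, S u -> S v -> GRing.comm u v) ->
  span S x -> span S y -> GRing.comm x y.
Proof.
move=> SC Sx Sy; apply: (Sx [set u | GRing.comm u y]) => [|u Su].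
  split=> [|a u v /= uy vy]; first exact/commr_sym/commr0.
  by rewrite /GRing.comm pzmulPl pzmulPr uy vy.
apply: (Sy [set v | GRing.comm u v]) => [|v Sv]; last exact: SC.
split=> [|a v w /= uv uw]; first exact: commr0.
by rewrite /GRing.comm pzmulPl pzmulPr uv uw.
Qed.

(** Only the number of letters g matters, not the Lyndon property: whatever the
    cut of w, a word without g gives a multiple of h, a word with one g gives a
    combination of the iterated brackets, and a word with two or more letters g
    gives a bracket of two such combinations or a bracket with 0. *)
Lemma E_rec_kill (B : pzAlgType K) (f : {linear T -> B}) :
  monoid_morphism f -> pairwise_comm (f (gT K)) (f (hT K)) ->
  forall m w, w != [::] ->
  [/\ count_mem lg w = 0%N -> exists c : K, f (E_rec K m w) = c *: f (hT K),
      count_mem lg w = 1%N ->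
        span [set ad_pow (f (hT K)) k (f (gT K)) | k in [set: nat]] (f (E_rec K m w))
    & (2 <= count_mem lg w)%N -> f (E_rec K m w) = 0].
Proof.
move=> fM fC; set X := [set ad_pow _ _ _ | _ in _].
have Xsub := span_subspace X.
have XC x y : span X x -> span X y -> x * y = y * x.
  by apply: span_comm => _ _ [i _ <-] [k _ <-].
have XD x (c : K) : span X x -> span X (x * (c *: f (hT K)) - (c *: f (hT K)) * x).
  move=> Xx; apply: (Xx [set x | span X (x * (c *: f (hT K)) - (c *: f (hT K)) * x)]).
    split=> [|a u v Xu Xv]; rewrite /= ?mul0r ?mulr0 ?subrr; first exact: Xsub.1.
    rewrite pzmulPl pzmulPr opprD addrACA -scalerBr; exact: Xsub.2.
  move=> _ [k _ <-] /=; rewrite -pzscalerAl -pzscalerAr -scalerBr -ad_powS -[_ *: _]addr0.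
  by apply: Xsub.2; [apply: sub_span; exists k.+1 | apply: Xsub.1].
have XN x : span X x -> span X (- x).
  by move=> Xx; rewrite -[- x]addr0 -scaleN1r; apply: Xsub.2 => //; apply: Xsub.1.
elim=> [|m IH] w w0 /=.
  by rewrite linear0; split=> // _; [exists 0; rewrite scale0r | apply: Xsub.1].
case: (leqP (size w) 1) => w1.
  case: w w0 w1 => [|[] [|c' w]] // _ _; split=> //= _.
    by exists 1; rewrite scale1r.
  by apply: sub_span; exists 0%N.
have /andP[c0 cw] := std_cut_bounds w1.
have := congr1 (count_mem lg) (cat_take_drop (std_cut w) w).
set u := take _ w; set v := drop _ w; rewrite count_cat => cE.
have u0 : u != [::] by rewrite -size_eq0 size_takel -?lt0n // ltnW.
have v0 : v != [::] by rewrite -size_eq0 size_drop subn_eq0 -ltnNge.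
have [u00 u1 u2] := IH u u0; have [v00 v1 v2] := IH v v0.
rewrite linearB /= !fM.2 -cE.
case: (count_mem lg u) u00 u1 u2 => [|[|a]] /=.
- move=> /(_ erefl)[c ->] _ _; rewrite add0n; split.
  + move=> /v00[c' ->]; exists 0; rewrite scale0r.
    by rewrite -!pzscalerAl -!pzscalerAr !scalerA mulrC subrr.
  + by move=> /v1/(XD _ c)/XN; rewrite opprB.
  + by move=> /v2 ->; rewrite mulr0 mul0r subrr.
- move=> _ /(_ erefl) Xu _; rewrite add1n; split=> //.
  + by move=> [/v00[c ->]]; apply: XD.
  + case: (count_mem lg v) v1 v2 => [|[|b]] //; last first.
      by move=> _ -> // _; rewrite mulr0 mul0r subrr.
    by move=> /(_ erefl) Xv _ _; rewrite XC // subrr.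
by move=> _ _ -> //; rewrite mulr0 mul0r subrr.
Qed.

Lemma free_lift_g (B : pzAlgType K) (a b : B) :
  free_lift (fun x => if x == lg then a else b) (gT K) = a.
Proof. by rewrite /gT free_liftE big_seq1. Qed.

Lemma free_lift_h (B : pzAlgType K) (a b : B) :
  free_lift (fun x => if x == lg then a else b) (hT K) = b.
Proof. by rewrite /hT free_liftE big_seq1. Qed.

(** Together with [Tbar_relations] this says that the relations present the algebra. *)
Theorem Tbar_lift (B : pzAlgType K) (f : {linear T -> B}) : monoid_morphism f ->
  relations (f (gT K)) (f (hT K)) ->
  exists F : {linear A -> B}, monoid_morphism F /\ forall x, F (pi x) = f x.
Proof.
move=> fM [fC fg fo fh fp].
have fE k : f (E K (omega k)) = ad_pow (f (hT K)) k (f (gT K)).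
  by rewrite E_omega morph_ad_pow.
have [|F1 [F1M F1E]] := @quotalg_lift K T B _ f fM (_ : forall x,
    [set E K w | w in [set w | lyndon w && (2 <= count_mem lg w)%N]] x -> f x = 0).
  move=> _ [w /= /andP[/andP[w0 _] w2] <-].
  by have [_ _ ->] := E_rec_kill fM fC (size w) w0.
have [|F2 [F2M F2E]] := @quotalg_lift K (Tbar K) B [set Tbar_pi (gT K) ^+ n - 1] F1 F1M.
  by move=> _ ->; rewrite linearB /= morph_exp // F1M.1 F1E fg subrr.
have [|F3 [F3M F3E]] := @quotalg_lift K (Tbar_n K n) B
    [set Tbar_n_pi n (E K (omega p.-1))] F2 F2M.
  by move=> _ ->; rewrite F2E F1E fE fo.
have [|F4 [F4M F4E]] := @quotalg_lift K (Tbar_n_p' K n p) B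
    [set Tbar_n_p'_pi n p (hT K) ^+ p] F3 F3M.
  by move=> _ ->; rewrite morph_exp // F3E F2E F1E fh.
have [|F5 [F5M F5E]] := @quotalg_lift K (Tbar_n_p K n p) B
    [set Tbar_n_p_pi n p (E K (omega k)) ^+ (p ^ d k) |
      k in [set k | (1 <= k <= j)%N]] F4 F4M.
  by move=> _ [k /= kj <-]; rewrite morph_exp // F4E F3E F2E F1E fE fp.
by exists F5; split=> // x; rewrite F5E F4E F3E F2E F1E.
Qed.

Lemma Tbar_n_p_d_pi_surj (x : A) : exists y, x = pi y.
Proof.
have [x1 ->] := qalg_surj x; have [x2 ->] := qalg_surj x1.
have [x3 ->] := qalg_surj x2; have [x4 ->] := qalg_surj x3.
by have [x5 ->] := qalg_surj x4; exists x5.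
Qed.

Lemma pi_morph : monoid_morphism pi.
Proof. by split=> [|x y]; rewrite ?rmorph1 ?rmorphM. Qed.

Lemma Tbar_relations : relations (pi (gT K)) (pi (hT K)).
Proof.
have piE k : ad_pow (pi (hT K)) k (pi (gT K)) = pi (E K (omega k)).
  by rewrite E_omega morph_ad_pow //; apply: pi_morph.
have q0 (B : pzAlgType K) (S : set B) x : S x -> qalg S x = 0.
  by move=> Sx; apply: (qalg_eq0 S x).2; apply: sub_ideal_gen.
have z4 x : Tbar_n_p_pi n p x = 0 -> pi x = 0.
  by move=> e; rewrite -[pi x]/(qalg _ (Tbar_n_p_pi n p x)) e linear0.
have z3 x : Tbar_n_p'_pi n p x = 0 -> pi x = 0.
  by move=> e; apply: z4; rewrite -[LHS]/(qalg _ (Tbar_n_p'_pi n p x)) e linear0.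
have z2 x : Tbar_n_pi n x = 0 -> pi x = 0.
  by move=> e; apply: z3; rewrite -[LHS]/(qalg _ (Tbar_n_pi n x)) e linear0.
have z1 x : Tbar_pi x = 0 -> pi x = 0.
  by move=> e; apply: z2; rewrite -[LHS]/(qalg _ (Tbar_pi x)) e linear0.
have lt_comm a b : (a < b)%N -> GRing.comm (pi (E K (omega a))) (pi (E K (omega b))).
  move=> ab; apply/eqP; rewrite -subr_eq0 -!rmorphM -rmorphB -E_omega_cat; apply/eqP.
  apply: z1; apply: q0; exists (omega a ++ omega b) => //=.
  by rewrite lyndon_omega_cat //= count_cat /= !count_nseq.
split.
- move=> i k; rewrite !piE; case: (ltngtP i k) => [||->]; first exact: lt_comm.
    by move=> /lt_comm; apply: commr_sym.
  exact: commr_refl.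
- apply/eqP; rewrite -subr_eq0 -rmorphXn -(rmorph1 pi) -rmorphB; apply/eqP.
  by apply: z2; apply: q0; rewrite /= rmorphB rmorphXn rmorph1.
- by rewrite piE; apply: z3; apply: q0.
- by rewrite -rmorphXn; apply: z4; apply: q0; rewrite /= rmorphXn.
move=> k kj; rewrite piE -rmorphXn; apply: q0.
by exists k => //; rewrite rmorphXn.
Qed.

End UniversalProperty.

(** * The relations are stable under the comultiplication *)

Lemma pchar_expDn_comm (R : pzRingType) (p e : nat) (x y : R) :
  prime p -> p%:R = 0 :> R -> GRing.comm x y ->
  (x + y) ^+ (p ^ e) = x ^+ (p ^ e) + y ^+ (p ^ e).
Proof.
move=> p_pr pR0; elim: e x y => [|e IH] x y cxy; first by rewrite !expr1.
rewrite expnS !exprM -IH; last exact/commrX/commr_sym/commrX/commr_sym.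
congr (_ ^+ _); have [R0|R1] := eqVneq (1 : R) 0.
  have z (u : R) : u = 0 by rewrite -[u]mul1r R0 mul0r.
  by rewrite [LHS]z [RHS]z.
pose NZ := GRing.PzSemiRing_isNonZero.Build R R1.
pose R' : nzRingType := HB.pack (R : Type) (GRing.PzRing.class R) NZ.
have charR : p \in [pchar R'] by rewrite inE p_pr; apply/eqP.
exact: (pFrobenius_autD_comm charR cxy).
Qed.

Lemma pchar_alg0 (K : fieldType) (A : pzAlgType K) p : p \in [pchar K] ->
  p%:R = 0 :> A.
Proof. by move=> cK; rewrite -scaler_nat (pcharf0 cK) scale0r. Qed.

Section TensorCalculus.
Variables (K : fieldType) (U V : lmodType K).

Lemma tens0l (v : V) : (0 : U) ⊗ v = 0.
Proof.
by have := tens_linearl v 1 (0 : U) 0; rewrite !scale1r addr0 => /esym/eqP;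
  rewrite -subr_eq0 addrK => /eqP.
Qed.
Lemma tens0r (u : U) : u ⊗ (0 : V) = 0. Proof. exact: linear0. Qed.
Lemma tensDl (u u' : U) (v : V) : (u + u') ⊗ v = u ⊗ v + u' ⊗ v.
Proof. by have := tens_linearl v 1 u u'; rewrite !scale1r. Qed.
Lemma tensBl (u u' : U) (v : V) : (u - u') ⊗ v = u ⊗ v - u' ⊗ v.
Proof. by have := tens_linearl v (-1) u' u; rewrite !scaleN1r ![- _ + _]addrC. Qed.
Lemma tensZl c (u : U) (v : V) : (c *: u) ⊗ v = c *: (u ⊗ v).
Proof. by have := tens_linearl v c u 0; rewrite tens0l !addr0. Qed.
Lemma tensBr (u : U) (v v' : V) : u ⊗ (v - v') = u ⊗ v - u ⊗ v'.
Proof. exact: linearB. Qed.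

End TensorCalculus.

Lemma tens_exp (K : fieldType) (A B : pzAlgType K) (u : A) (v : B) m :
  (u ⊗ v : tens_alg A B) ^+ m = (u ^+ m) ⊗ (v ^+ m).
Proof. by elim: m => [|m IH]; rewrite ?expr0 // !exprS IH tensM. Qed.

Section ComulRelations.
Variables (K : fieldType) (B : pzAlgType K) (a b : B).
Local Notation x := (fun k => ad_pow b k a).
Local Notation BB := (tens_alg B B).
Local Notation H := ((1 : B) ⊗ b + b ⊗ a : BB).
Hypothesis xC : pairwise_comm a b.

(** The subalgebra, without unit, generated by the iterated brackets: it is
    commutative and stable under the derivation [-, b]. *)
Inductive xalg : B -> Prop :=
| xalg_gen k : xalg (x k)
| xalg_add u v : xalg u -> xalg v -> xalg (u + v)
| xalg_mul u v : xalg u -> xalg v -> xalg (u * v).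

Lemma xalg_comm u v : xalg u -> xalg v -> GRing.comm u v.
Proof.
move=> Xu Xv; elim: Xu => [k|u1 u2 _ c1 _ c2|u1 u2 _ c1 _ c2]; last first.
- exact/commr_sym/commrM/commr_sym.
- by apply/commr_sym/commrD; apply/commr_sym.
by elim: Xv => [l|v1 v2 _ c1 _ c2|v1 v2 _ c1 _ c2];
  [apply: xC | apply: commrD | apply: commrM].
Qed.

Lemma xalg_ad u : xalg u -> xalg [comm u, b].
Proof.
elim=> [k|u1 u2 X1 D1 X2 D2|u1 u2 X1 D1 X2 D2]; first exact: (xalg_gen k.+1).
  by rewrite mulrDl mulrDr opprD addrACA; apply: xalg_add.
have -> : [comm u1 * u2, b] = u1 * [comm u2, b] + [comm u1, b] * u2.
  by rewrite mulrBr mulrBl !mulrA addrA subrK.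
by apply: xalg_add; apply: xalg_mul.
Qed.

(** Inductions on sums of pure tensors follow the constructors directly. The lower
    bound isolates, in the comultiplication of x_k, the terms killed by the powers
    of x_1, ..., x_k from the single term with i = 0. *)
Inductive xtens (l k : nat) : BB -> Prop :=
| xtens0 : xtens l k 0
| xtens_cons i q y : (l <= i <= k)%N -> xalg q -> xtens l k y ->
    xtens l k (x i ⊗ q + y).

Lemma xtens1 l k i q : (l <= i <= k)%N -> xalg q -> xtens l k (x i ⊗ q).
Proof. by move=> ik Xq; rewrite -[_ ⊗ _]addr0; apply: xtens_cons => //; apply: xtens0. Qed.

Lemma xtens_add l k y z : xtens l k y -> xtens l k z -> xtens l k (y + z).
Proof.
elim=> [|i q y' ik Xq _ IH] Xz; first by rewrite add0r.
by rewrite -addrA; apply: xtens_cons => //; apply: IH.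
Qed.

Lemma xtens_weak l k l' k' y : (l' <= l)%N -> (k <= k')%N ->
  xtens l k y -> xtens l' k' y.
Proof.
move=> ll kk; elim=> [|i q y' ik Xq _ IH]; first exact: xtens0.
by apply: xtens_cons => //; lia.
Qed.

(** The bracket with 1 ⊗ b acts on the right factor, and the bracket with b ⊗ a
    raises i because a commutes with q. *)
Lemma ad_tens i q : xalg q ->
  [comm (x i ⊗ q : BB), H] = x i ⊗ [comm q, b] + x i.+1 ⊗ (q * a).
Proof.
move=> Xq; have qa : q * a = a * q := xalg_comm Xq (xalg_gen 0).
rewrite mulrDr mulrDl !(@tensM K B B) mulr1 mul1r.
by rewrite opprD addrACA -tensBr -qa -tensBl.
Qed.

Lemma xtens_ad l k y : xtens l k y -> xtens l k.+1 [comm y, H].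
Proof.
elim=> [|i q y' ik Xq _ IH]; first by rewrite mul0r mulr0 subrr; apply: xtens0.
rewrite mulrDl [_ * (_ + y')]mulrDr opprD addrACA ad_tens //.
apply: xtens_add IH; apply: xtens_add; apply: xtens1; try lia.
  exact: xalg_ad.
by apply: xalg_mul Xq _; apply: (xalg_gen 0).
Qed.

(** The term with i = 0 is kept apart: bracketing a ⊗ x_k produces a ⊗ x_(k+1) and
    one new term with i = 1. *)
Lemma comul_ad_pow k : exists2 y, xtens 1 k y &
  ad_pow H k (a ⊗ a : BB) = a ⊗ x k + y.
Proof.
elim: k => [|k [y Yy IH]]; first by exists 0; [apply: xtens0 | rewrite addr0].
exists (x 1 ⊗ (x k * a) + [comm y, H]).
  apply: xtens_cons => //; last exact: xtens_ad.
  by apply: xalg_mul; [apply: xalg_gen | apply: (xalg_gen 0)].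
rewrite ad_powS IH mulrDl [_ * (_ + y)]mulrDr opprD addrACA.
by rewrite -[a ⊗ _]/(x 0 ⊗ x k) ad_tens ?addrA //; apply: xalg_gen.
Qed.

Lemma xtens_ad_pow k : xtens 0 k (ad_pow H k (a ⊗ a : BB)).
Proof.
have [y Yy ->] := comul_ad_pow k.
by apply: (@xtens_cons _ _ 0) (xtens_weak _ _ Yy) => //; apply: xalg_gen.
Qed.

Lemma xtens_comm l k l' k' y z : xtens l k y -> xtens l' k' z -> GRing.comm y z.
Proof.
move=> Xy Xz; elim: Xy => [|i q y' _ Xq _ IH]; first exact/commr_sym/commr0.
apply/commr_sym/commrD; apply/commr_sym => //.
elim: Xz => [|i' q' z' _ Xq' _ IH']; first exact: commr0.
apply: commrD => //; rewrite /GRing.comm !(@tensM K B B).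
by rewrite (xalg_comm Xq Xq') (xC i i').
Qed.

Lemma comul_pairwise_comm : pairwise_comm (a ⊗ a : BB) H.
Proof. by move=> i k; apply: xtens_comm (xtens_ad_pow i) (xtens_ad_pow k). Qed.

Variable p : nat.
Hypothesis charK : p \in [pchar K].
Let p_pr : prime p. Proof. exact: pcharf_prime charK. Qed.

Lemma xtens_exp0 k e y : (forall i, (1 <= i <= k)%N -> x i ^+ (p ^ e) = 0) ->
  xtens 1 k y -> y ^+ (p ^ e) = 0.
Proof.
have pe0 : (0 < p ^ e)%N by rewrite expn_gt0 prime_gt0.
move=> x0; elim=> [|i q y' ik Xq Xy' IH]; first by rewrite expr0n gtn_eqF.
rewrite pchar_expDn_comm ?IH ?addr0 //; first by rewrite tens_exp x0 // tens0l.
  exact: pchar_alg0.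
by apply: xtens_comm Xy'; apply: xtens1 ik Xq.
Qed.

(** The iterated brackets of s ⊗ a by 1 ⊗ b are the s ⊗ x_k, since s ⊗ 1 commutes
    with 1 ⊗ b. Taking s = b gives the p-th power of the comultiplication of h, and
    s = b + a that of the comultiplication of h + g. *)
Lemma comul_jacobson (s : B) :
  ((1 : B) ⊗ b + s ⊗ a : BB) ^+ p =
    (1 : B) ⊗ (b ^+ p) + (s ^+ p) ⊗ (a ^+ p) + s ⊗ x p.-1.
Proof.
have adE k : ad_pow ((1 : B) ⊗ b : BB) k (s ⊗ a) = s ⊗ x k.
  by elim: k => // k IH; rewrite ad_powS IH !(@tensM K B B) mulr1 mul1r -tensBr.
rewrite (jacobson p_pr (pchar_alg0 _ charK)); first by rewrite !tens_exp adE expr1n.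
by move=> k; rewrite adE /GRing.comm !(@tensM K B B) (xC k 0).
Qed.

(** This is what makes the comultiplication descend to the quotient. Since the brackets
    commute, the bracket relation for p - 1 is the difference of three p-th powers
    given by Jacobson's formula. In the power relation for k, the Frobenius map
    turns x_i ⊗ q into x_i^(p^d_k) ⊗ q^(p^d_k), which vanishes because d_i <= d_k. *)
Lemma comul_relations n j d :
  (forall i k, (1 <= i <= k)%N -> (k <= j)%N -> (d i <= d k)%N) ->
  relations n p j d a b -> relations n p j d (a ⊗ a : BB) H.
Proof.
move=> d_mono [_ an xp bp xd].
have Hp : H ^+ p = 0 by rewrite comul_jacobson bp xp !tens0r tens0l !addr0.
split=> //; first exact: comul_pairwise_comm.
- by rewrite tens_exp an.
- have := jacobson p_pr (pchar_alg0 BB charK) (fun k => comul_pairwise_comm k 0).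
  (* Δ(h) + Δ(g) is again of the form 1 ⊗ b + s ⊗ a, so its p-th power is known;
     comparing the two expressions isolates the bracket of order p - 1. *)
  have -> : H + a ⊗ a = (1 : B) ⊗ b + (b + a) ⊗ a by rewrite tensDl addrA.
  rewrite comul_jacobson (jacobson p_pr (pchar_alg0 B charK) (fun k => xC k 0)).
  rewrite Hp bp xp !tens0r tens_exp !add0r !addr0 => /eqP.
  by rewrite -subr_eq0 opprD addrA subrr sub0r oppr_eq0 => /eqP.
move=> k /andP[k1 kj]; have [y Yy ->] := comul_ad_pow k.
rewrite pchar_expDn_comm //; last 2 first.
- exact: pchar_alg0.
- by apply: xtens_comm Yy; apply: (@xtens1 0 k 0) => //; apply: xalg_gen.
rewrite tens_exp xd ?k1 // tens0r add0r; apply: xtens_exp0 Yy => i ik.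
rewrite -(subnKC (d_mono i k ik kj)) expnD exprM xd ?expr0n.
  by rewrite gtn_eqF // expn_gt0 prime_gt0.
by lia.
Qed.

End ComulRelations.

(** * Convolution and the antipode of the free algebra *)

Section Convolution.
Variables (K : fieldType) (C : lmodType K) (H : coalgebra C) (A : pzAlgType K).

Definition conv (f g : {linear C -> A}) (x : C) : A :=
  mul_map (tens_map f g (comul H x)).

Fact conv_linear f g : linear (conv f g).
Proof. by move=> a x y; rewrite /conv !linearP. Qed.
HB.instance Definition _ f g := GRing.isLinear.Build K C A *:%R (conv f g) (conv_linear f g).

Definition conv_unit (x : C) : A := (counit H x : K) *: (1 : A).

Fact conv_unit_linear : linear conv_unit.
Proof. by move=> a x y; rewrite /conv_unit linearP scalerDl scalerA. Qed.
HB.instance Definition _ := GRing.isLinear.Build K C A *:%R conv_unit conv_unit_linear.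

Lemma convA (f g h : {linear C -> A}) x : conv f (conv g h) x = conv (conv f g) h x.
Proof.
have assocE (t : (C ⊗ C ⊗ C)%type) :
    mul_map (tens_map f (@mul_map K A \o tens_map g h) (tens_assoc t)) =
    mul_map (tens_map (@mul_map K A \o tens_map f g) h t).
  move: t; apply: tens_ext => [a u v|a u v|t w]; rewrite ?linearP //.
  move: t; apply: tens_ext => [a u v|a u v|u v]; rewrite ?tens_linearl ?linearP //.
  by rewrite tens_assocE !tens_mapE /= !tens_mapE !mul_mapE mulrA.
rewrite /conv; transitivity (mul_map (tens_map f (@mul_map K A \o tens_map g h)
    (tens_map idfun (comul H) (comul H x)))).
  move: (comul H x); apply: tens_ext => [a u v|a u v|u v]; rewrite ?linearP //.
  by rewrite !tens_mapE.
rewrite -comul_assoc assocE.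
move: (comul H x); apply: tens_ext => [a u v|a u v|u v]; rewrite ?linearP //.
by rewrite !tens_mapE.
Qed.

Lemma conv1f (f : {linear C -> A}) x : conv conv_unit f x = f x.
Proof.
rewrite /conv -[in RHS](counit_left H x).
move: (comul H x); apply: tens_ext => [a u v|a u v|u v]; rewrite ?linearP //.
by rewrite !tens_mapE mul_mapE /= tens_lunitE /conv_unit linearZ -pzscalerAl mul1r.
Qed.

Lemma convf1 (f : {linear C -> A}) x : conv f conv_unit x = f x.
Proof.
rewrite /conv -[in RHS](counit_right H x).
move: (comul H x); apply: tens_ext => [a u v|a u v|u v]; rewrite ?linearP //.
by rewrite !tens_mapE mul_mapE /= tens_runitE /conv_unit linearZ -pzscalerAr mulr1.
Qed.

End Convolution.

Lemma conv_coalgebra_map (K : fieldType) (C C' : lmodType K) (H : coalgebra C)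
    (H' : coalgebra C') (A : pzAlgType K) (q : {linear C -> C'}) (f g : {linear C' -> A}) x :
  (forall x, comul H' (q x) = tens_map q q (comul H x)) ->
  conv H (f \o q) (g \o q) x = conv H' f g (q x).
Proof.
move=> qD; rewrite /conv qD; move: (comul H x).
apply: tens_ext => [a u v|a u v|u v]; rewrite ?linearP //.
by rewrite !tens_mapE.
Qed.

Section Opposite.
Variables (K : fieldType) (A : pzAlgType K).

Definition op_alg : pzAlgType K :=
  @PzAlg K A 1 (fun x y : A => y * x) (fun x y z => esym (mulrA z y x))
    (@mulr1 A) (@mul1r A) (fun y a u v => pzmulPr a u v y) (fun x a u v => pzmulPl a u v x).

End Opposite.

Section AntiMorphism.
Variables (K : fieldType) (C A : pzAlgType K) (f s : {linear C -> A}).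
Hypothesis fM : monoid_morphism f.
Hypothesis sM : forall x y, s (x * y) = s y * s x.

(** In Sweedler notation, s(t_1 u_1) f(t_2 u_2) = s(u_1) (s(t_1) f(t_2)) f(u_2),
    and the inner factor is a scalar: so the antipode identity need only be checked
    on generators. *)
Lemma antimorph_mull (t u : tens_alg C C) (c : K) :
  mul_map (tens_map s f t) = c *: (1 : A) ->
  mul_map (tens_map s f (t * u)) = c *: mul_map (tens_map s f u).
Proof.
move=> tc; have sandwich u1 u2 : mul_map (tens_map s f (t * (u1 ⊗ u2 : tens_alg C C))) =
    s u1 * mul_map (tens_map s f t) * f u2.
  move: t {tc}; apply: tens_ext => [a v w|a v w|v w].
  - by rewrite pzmulPl !linearP.
  - by rewrite !linearP pzmulPr pzmulPl.
  by rewrite (@tensM K C C) !tens_mapE !mul_mapE sM fM.2 !mulrA.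
move: u; apply: tens_ext => [a v w|a v w|v w].
- by rewrite pzmulPr !linearP.
- by rewrite !linearP.
by rewrite sandwich tc -pzscalerAr mulr1 -pzscalerAl tens_mapE mul_mapE.
Qed.

Lemma antimorph_mulr (t u : tens_alg C C) (c : K) :
  mul_map (tens_map f s u) = c *: (1 : A) ->
  mul_map (tens_map f s (t * u)) = c *: mul_map (tens_map f s t).
Proof.
move=> uc; have sandwich t1 t2 : mul_map (tens_map f s ((t1 ⊗ t2 : tens_alg C C) * u)) =
    f t1 * mul_map (tens_map f s u) * s t2.
  move: u {uc}; apply: tens_ext => [a v w|a v w|v w].
  - by rewrite pzmulPr !linearP.
  - by rewrite !linearP pzmulPr pzmulPl.
  by rewrite (@tensM K C C) !tens_mapE !mul_mapE sM fM.2 !mulrA.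
move: t; apply: tens_ext => [a v w|a v w|v w].
- by rewrite pzmulPl !linearP.
- by rewrite !linearP.
by rewrite sandwich uc -pzscalerAr mulr1 -pzscalerAl tens_mapE mul_mapE.
Qed.

End AntiMorphism.

Section FreeAntipode.
Variables (K : fieldType) (A : pzAlgType K) (f : {linear free_alg K -> A}).
Local Notation T := (free_alg K).
Variable ginv : A.
Hypothesis fM : monoid_morphism f.
Hypothesis ginvL : ginv * f (gT K) = 1.
Hypothesis ginvR : f (gT K) * ginv = 1.

(** The only possible anti-morphism: h is skew-primitive, so it must go to
    -h g^-1. *)
Definition free_antipode (x : T) : A :=
  @free_lift K (op_alg A) (fun c => if c == lg then ginv else - (f (hT K) * ginv)) x.

Fact free_antipode_linear : linear free_antipode.
Proof. exact: (@free_lift_linear K (op_alg A)). Qed.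
HB.instance Definition _ :=
  GRing.isLinear.Build K T A *:%R free_antipode free_antipode_linear.

Lemma free_antipodeM x y : free_antipode (x * y) = free_antipode y * free_antipode x.
Proof. exact: (@free_lift_monoid_morphism K (op_alg A) _).2. Qed.

Lemma free_antipode1 : free_antipode 1 = 1.
Proof. exact: (@free_lift_monoid_morphism K (op_alg A) _).1. Qed.

Lemma free_antipode_g : free_antipode (gT K) = ginv.
Proof. exact: (@free_lift_g K (op_alg A)). Qed.

Lemma free_antipode_h : free_antipode (hT K) = - (f (hT K) * ginv).
Proof. exact: (@free_lift_h K (op_alg A)). Qed.

Lemma free_comulM (x y : T) :
  free_comul (x * y) = (free_comul x : tens_alg T T) * free_comul y.
Proof. exact: (free_comul_morph K).2. Qed.

Lemma free_ind (P : set T) : subspace P -> P 1 ->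
  (forall x, P x -> P (gT K * x)) -> (forall x, P x -> P (hT K * x)) ->
  forall x, P x.
Proof.
move=> Psub P1 Pg Ph x; apply: (monomial_span x Psub) => _ [w _ <-].
elim: w => [|[] w IH]; rewrite ?monomial0 // -cat1s monomialM; [exact: Ph | exact: Pg].
Qed.

Local Notation H := (free_bialgebra K).

Lemma conv_eq_subspace (u v w : {linear T -> A}) :
  subspace [set x | conv H u v x = w x].
Proof.
split=> [|a x y /= xE yE]; rewrite /= ?linear0 // !linearP.
by congr (_ *: _ + _).
Qed.

Lemma free_antipode_left x : conv H free_antipode f x = conv_unit H A x.
Proof.
apply: (free_ind (P := [set x | conv H free_antipode f x = conv_unit H A x])).
- exact: conv_eq_subspace.
- rewrite /= /conv /conv_unit /= free_comul1 free_counit1 tens_mapE mul_mapE.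
  by rewrite /= free_antipode1 fM.1 scale1r mulr1.
- move=> {}x /= xE; rewrite /conv /= free_comulM.
  have gE : mul_map (tens_map free_antipode f (free_comul (gT K))) = 1 *: (1 : A).
    by rewrite free_comul_g tens_mapE mul_mapE /= free_antipode_g ginvL scale1r.
  rewrite (antimorph_mull fM free_antipodeM _ gE) scale1r [LHS]xE.
  by rewrite /conv_unit /= (free_counit_morph K).2 free_counit_g mul1r.
move=> {}x /= xE; rewrite /conv /= free_comulM.
have hE : mul_map (tens_map free_antipode f (free_comul (hT K))) = 0 *: (1 : A).
  rewrite free_comul_h !linearD /= !tens_mapE !mul_mapE /= free_antipode_h free_antipode1.
  by rewrite mul1r mulNr -mulrA ginvL mulr1 subrr scale0r.
rewrite (antimorph_mull fM free_antipodeM _ hE) scale0r.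
by rewrite /conv_unit /= (free_counit_morph K).2 free_counit_h mul0r scale0r.
Qed.

Lemma free_antipode_right x : conv H f free_antipode x = conv_unit H A x.
Proof.
apply: (monomial_span x (W := [set x | conv H f free_antipode x = conv_unit H A x])).
  exact: conv_eq_subspace.
move=> _ [w _ <-]; elim/last_ind: w => [|w c IH] /=.
  rewrite monomial0 /conv /conv_unit /= free_comul1 free_counit1 tens_mapE mul_mapE.
  by rewrite /= free_antipode1 fM.1 scale1r mulr1.
rewrite -cats1 monomialM /conv /= free_comulM.
pose e : K := if c == lg then 1 else 0.
have ce : mul_map (tens_map f free_antipode (free_comul (monomial K [:: c]))) = e *: (1 : A).
  rewrite /e; case: (c) => /=.
    rewrite -[monomial _ _]/(hT K) free_comul_h !linearD /= !tens_mapE !mul_mapE /=.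
    by rewrite free_antipode_h free_antipode_g fM.1 mul1r addNr scale0r.
  rewrite -[monomial _ _]/(gT K) free_comul_g tens_mapE mul_mapE /=.
  by rewrite free_antipode_g ginvR scale1r.
rewrite (antimorph_mulr fM free_antipodeM _ ce) /conv_unit /= (free_counit_morph K).2.
have -> : free_counit (monomial K [:: c]) = e.
  by rewrite /e; case: (c); [apply: free_counit_h | apply: free_counit_g].
by rewrite mulrC -scalerA; congr (_ *: _).
Qed.

End FreeAntipode.

(** * Bialgebra and Hopf structures on a quotient *)

Lemma conv_ext (K : fieldType) (C : lmodType K) (H : coalgebra C) (A : pzAlgType K)
    (f f' g g' : {linear C -> A}) x :
  f =1 f' -> g =1 g' -> conv H f g x = conv H f' g' x.
Proof.
move=> ff gg; rewrite /conv; move: (comul H x).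
apply: tens_ext => [a u v|a u v|u v]; rewrite ?linearP //.
by rewrite !tens_mapE ff gg.
Qed.

Lemma conv_subr (K : fieldType) (C : lmodType K) (H : coalgebra C) (A : pzAlgType K)
    (f g h : {linear C -> A}) x :
  conv H f (g \- h) x = conv H f g x - conv H f h x.
Proof.
pose F : {linear (C ⊗ C)%type -> A} := @mul_map K A \o tens_map f (g \- h).
pose G : {linear (C ⊗ C)%type -> A} :=
  (@mul_map K A \o tens_map f g) \- (@mul_map K A \o tens_map f h).
apply: (tens_ext (f := F) (g := G)) => [||u v]; try exact: linearP.
by rewrite /F /G /= !tens_mapE !mul_mapE /= mulrBr.
Qed.

Section QuotientBialgebra.
Variables (K : fieldType) (C A : pzAlgType K) (HC : bialgebra C).
Variable q : {linear C -> A}.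
Hypothesis q_surj : forall y, exists x, y = q x.
Variable D : {linear A -> (A ⊗ A)%type}.
Hypothesis DM : monoid_morphism (D : A -> tens_alg A A).
Hypothesis Dq : forall x, D (q x) = tens_map q q (comul HC x).
Variable e : {linear A -> K^o}.
Hypothesis eM : monoid_morphism (e : A -> K).
Hypothesis eq : forall x, e (q x) = counit HC x.

Lemma quotient_comul_assoc x :
  tens_assoc (tens_map D idfun (D x)) = tens_map idfun D (D x).
Proof.
have [{}x ->] := q_surj x; rewrite Dq.
transitivity (tens_map q (tens_map q q) (tens_assoc (tens_map (comul HC) idfun (comul HC x)))).
  move: (comul HC x); apply: tens_ext => [a u v|a u v|u v]; rewrite ?linearP //.
  rewrite !tens_mapE /= Dq; move: (comul HC u).
  apply: tens_ext => [a s t|a s t|s t]; 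
    rewrite ?linearP ?tens_linearl ?linearP ?tens_linearl ?linearP //.
  by rewrite !tens_mapE !tens_assocE !tens_mapE /= tens_mapE.
rewrite comul_assoc.
move: (comul HC x); apply: tens_ext => [a u v|a u v|u v]; rewrite ?linearP //.
by rewrite !tens_mapE /= Dq.
Qed.

Lemma quotient_counit_left x : tens_lunit (tens_map e idfun (D x)) = x.
Proof.
have [{}x ->] := q_surj x; rewrite Dq -[in RHS](counit_left HC x).
move: (comul HC x); apply: tens_ext => [a u v|a u v|u v]; rewrite ?linearP //.
by rewrite !tens_mapE !tens_lunitE linearZ /= eq.
Qed.

Lemma quotient_counit_right x : tens_runit (tens_map idfun e (D x)) = x.
Proof.
have [{}x ->] := q_surj x; rewrite Dq -[in RHS](counit_right HC x).
move: (comul HC x); apply: tens_ext => [a u v|a u v|u v]; rewrite ?linearP //.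
by rewrite !tens_mapE !tens_runitE linearZ /= eq.
Qed.

Definition quotient_bialgebra : bialgebra A :=
  @Bialgebra K A
    (@Coalgebra K A D e quotient_comul_assoc quotient_counit_left quotient_counit_right)
    DM eM.

End QuotientBialgebra.

Section HopfQuotient.
Variables (K : fieldType) (C A : pzAlgType K) (HC : bialgebra C) (HA : bialgebra A).
Variable q : {linear C -> A}.
Hypothesis q_surj : forall y, exists x, y = q x.
Hypothesis qH : bialgebra_morphism HC HA q.
Variables (s : {linear C -> A}) (S : {linear A -> A}).
Hypothesis Sq : forall x, S (q x) = s x.

Lemma hopf_of_quotient :
  (forall x, conv HC s q x = conv_unit HC A x) ->
  (forall x, conv HC q s x = conv_unit HC A x) ->
  exists H : hopf_algebra A, (H : bialgebra A) = HA /\ antipode H = S.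
Proof.
case: qH => qM qD qe sL sR.
have SL x : mul_map (tens_map S idfun (comul HA x)) = (counit HA x : K) *: (1 : A).
  have [{}x ->] := q_surj x; rewrite -[LHS]/(conv HA S idfun (q x)).
  rewrite -(conv_coalgebra_map _ _ _ qD) qe -[RHS]/(conv_unit HC A x) -sL.
  exact: conv_ext.
have SR x : mul_map (tens_map idfun S (comul HA x)) = (counit HA x : K) *: (1 : A).
  have [{}x ->] := q_surj x; rewrite -[LHS]/(conv HA idfun S (q x)).
  rewrite -(conv_coalgebra_map _ _ _ qD) qe -[RHS]/(conv_unit HC A x) -sR.
  exact: conv_ext.
by exists (HopfAlgebra SL SR).
Qed.

End HopfQuotient.

Section FreeDegree.
Variable K : fieldType.
Local Notation T := (free_alg K).
Local Notation H := (free_bialgebra K).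

Definition tens_degree (m : nat) : set (T ⊗ T)%type :=
  span [set t | exists u v : word,
    (count_mem lh u + count_mem lh v = m)%N /\ t = monomial K u ⊗ monomial K v].

Lemma tens_degree_g m t : tens_degree m t ->
  tens_degree m ((gT K ⊗ gT K : tens_alg T T) * t).
Proof.
have Tsub := span_subspace [set t : (T ⊗ T)%type | exists u v : word,
    (count_mem lh u + count_mem lh v = m)%N /\ t = monomial K u ⊗ monomial K v].
move=> tm; apply: (tm [set t | tens_degree m ((gT K ⊗ gT K : tens_alg T T) * t)]).
  split=> [|a x y xm ym] /=; first by rewrite mulr0; apply: Tsub.1.
  by rewrite (@pzmulPr K (tens_alg T T)); apply: Tsub.2.
move=> _ [u [v [uv ->]]] /=; rewrite (@tensM K T T) -!monomialM.
by apply: sub_span; exists (lg :: u), (lg :: v).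
Qed.

Lemma tens_degree_h m t : tens_degree m t ->
  tens_degree m.+1 (((1 : T) ⊗ hT K + hT K ⊗ gT K : tens_alg T T) * t).
Proof.
have Tsub := span_subspace [set t : (T ⊗ T)%type | exists u v : word,
    (count_mem lh u + count_mem lh v = m.+1)%N /\ t = monomial K u ⊗ monomial K v].
move=> tm; apply: (tm [set t |
    tens_degree m.+1 (((1 : T) ⊗ hT K + hT K ⊗ gT K : tens_alg T T) * t)]).
  split=> [|a x y xm ym] /=; first by rewrite mulr0; apply: Tsub.1.
  by rewrite (@pzmulPr K (tens_alg T T)); apply: Tsub.2.
move=> _ [u [v [uv ->]]] /=; rewrite mulrDl !(@tensM K T T) mul1r -!monomialM.
rewrite -[X in X + _]scale1r; apply: Tsub.2; apply: sub_span.
  by exists u, (lh :: v); split=> //=; rewrite add1n addnS; congr _.+1; apply: uv.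
by exists (lh :: u), (lg :: v); split=> //=; rewrite add0n add1n addSn; congr _.+1; apply: uv.
Qed.

Lemma comul_tens_degree w :
  tens_degree (count_mem lh w) (free_comul (monomial K w)).
Proof.
elim: w => [|c w IH].
  by rewrite monomial0 free_comul1; apply: sub_span; exists [::], [::]; rewrite monomial0.
rewrite -cat1s monomialM free_comulM; case: c; rewrite -?[monomial _ [:: _]]/(hT K).
  by rewrite free_comul_h; apply: tens_degree_h.
by rewrite -[monomial _ [:: _]]/(gT K) free_comul_g; apply: tens_degree_g.
Qed.

Lemma free_bounded (x : T) :
  exists m, span [set monomial K w | w in [set w | (count_mem lh w < m)%N]] x.
Proof.
pose B m := [set monomial K w | w in [set w | (count_mem lh w < m)%N]].
have Bmono m m' y : (m <= m')%N -> span (B m) y -> span (B m') y.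
  move=> mm; apply: span_min; first exact: span_subspace.
  by move=> _ [w /= wm <-]; apply: sub_span; exists w => //=; apply: leq_trans mm.
apply: (monomial_span x (W := [set x | exists m, span (B m) x])).
  split=> [|a y z [m ym] [m' zm]]; first by exists 0%N; apply: (span_subspace _).1.
  exists (m + m')%N; apply: (span_subspace _).2.
    by apply: Bmono ym; apply: leq_addr.
  by apply: Bmono zm; apply: leq_addl.
by move=> _ [w _ <-]; exists (count_mem lh w).+1; apply: sub_span; exists w => //=.
Qed.

End FreeDegree.

(** * The antipode of the free algebra descends *)

Section AntipodeDescends.
Variables (K : fieldType) (A : pzAlgType K) (HA : bialgebra A).
Local Notation T := (free_alg K).
Local Notation H := (free_bialgebra K).
Variables (q s : {linear T -> A}) (c : {linear A -> A}).
Hypothesis qH : bialgebra_morphism H HA q.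
Hypothesis sL : forall x, conv H s q x = conv_unit H A x.
Hypothesis c_deg0 : forall w, count_mem lh w = 0%N ->
  conv HA idfun c (q (monomial K w)) = conv_unit HA A (q (monomial K w)).

(** Suppose that c is convolution inverse to the identity in degree 0, and let
    ν = ηε - id * c, which vanishes in degree 0. From s * q = ηε one gets
    s = cq + s * (νq), and in s * (νq) the factor s is evaluated only in smaller
    degree. Hence in bounded degree s factors through q; this is the local
    nilpotence argument for the invertibility of the identity map of a filtered
    bialgebra. *)
Lemma antipode_bounded m : exists S : {linear A -> A},
  forall w, (count_mem lh w < m)%N -> s (monomial K w) = S (q (monomial K w)).
Proof.
pose nu : {linear A -> A} := conv_unit HA A \- conv HA idfun c.
have sE x : s x = c (q x) + conv H s (nu \o q) x.
  have [qM qD qe] := qH.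
  have -> : conv H s (nu \o q) x = s x - conv H s (conv H q (c \o q)) x.
    rewrite -[in RHS](convf1 H s x) -conv_subr; apply: conv_ext => // y.
    rewrite /= /conv_unit qe; congr (_ - _).
    by rewrite -(conv_coalgebra_map _ _ _ qD); apply: conv_ext.
  rewrite convA.
  have -> : conv H (conv H s q) (c \o q) x = c (q x).
    by rewrite -[RHS](conv1f H (c \o q) x); apply: conv_ext.
  by rewrite addrCA subrr addr0.
elim: m => [|m [S IH]]; first by exists \0.
exists (c \+ conv HA S nu) => w wm /=.
rewrite sE; congr (_ + _); have [qM qD qe] := qH.
rewrite -(conv_coalgebra_map _ _ _ qD) /conv /=.
have := @comul_tens_degree K w; move: (free_comul _) => t td.
apply: (td [set t | mul_map (tens_map s (nu \o q) t) =
                    mul_map (tens_map (S \o q) (nu \o q) t)]).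
  split=> [|a x y /= xE yE]; rewrite /= ?linear0 //.
  by rewrite !linearP /= xE yE.
move=> _ [u [v [uv ->]]]; rewrite /= !tens_mapE !mul_mapE /=.
have [v0|v0] := eqVneq (count_mem lh v) 0%N.
  by rewrite c_deg0 // subrr !mulr0.
by rewrite IH //; move: v0; rewrite -lt0n; lia.
Qed.

(** An element of the kernel has bounded degree, and there s factors through q. A
    bi-ideal of an arbitrary Hopf algebra need not be stable under the antipode. *)
Lemma antipode_kernel x : q x = 0 -> s x = 0.
Proof.
have [m xm] := free_bounded x; have [S SE] := antipode_bounded m => qx.
suff -> : s x = S (q x) by rewrite qx linear0.
apply: (xm [set x | s x = S (q x)]) => [|_ [w /= wm <-]]; last exact: SE.
by split=> [|a y z /= yE zE]; rewrite /= ?linear0 // !linearP yE zE.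
Qed.

End AntipodeDescends.

(** * Graded coalgebras with grouplike degree 0 are pointed *)

Section Subspaces.
Variables (K : fieldType) (V : lmodType K).
Implicit Types W N : set V.

Lemma subspaceZ W a x : subspace W -> W x -> W (a *: x).
Proof. by case=> W0 WD Wx; rewrite -[_ *: _]addr0; apply: WD. Qed.

Lemma subspaceD W x y : subspace W -> W x -> W y -> W (x + y).
Proof. by case=> W0 WD Wx Wy; rewrite -[x]scale1r; apply: WD. Qed.

Lemma subspaceB W x y : subspace W -> W x -> W y -> W (x - y).
Proof. by move=> Wsub Wx Wy; rewrite addrC -scaleN1r; apply: Wsub.2. Qed.

Lemma subspaceI W N : subspace W -> subspace N -> subspace (W `&` N).
Proof.
move=> [W0 WD] [N0 ND]; split=> // a x y [Wx Nx] [Wy Ny].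
by split; [apply: WD | apply: ND].
Qed.

Lemma subspace_ker (W : lmodType K) (f : {linear V -> W}) :
  subspace [set x | f x = 0].
Proof.
by split=> [|a x y /= xE yE]; rewrite /= ?linear0 // linearP xE yE scaler0 addr0.
Qed.

Lemma span_mono (S S' : set V) : S `<=` S' -> span S `<=` span S'.
Proof.
by move=> SS; apply: span_min (span_subspace _) _ => x /SS; apply: sub_span.
Qed.

(** Zorn's lemma provides a largest subset M for which the span of M and N meets
    W trivially; this span is a complement of W containing N. *)
Lemma subspace_projection W N : subspace W -> subspace N ->
  (forall x, W x -> N x -> x = 0) ->
  exists P : {linear V -> V},
    (forall x, W x -> P x = x) /\ (forall x, N x -> P x = 0) /\ (forall x, W (P x)).
Proof.
move=> Wsub Nsub WN.
pose good (M : set V) := forall x, W x -> span (M `|` N) x -> x = 0.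
have [|M [Mgood Mmax]] := @Zorn_bigcup V good.
  move=> F Fgood Ftot x Wx.
  have [[A FA]|F0] := pselect (exists A, F A); last first.
    have -> : \bigcup_(X in F) X = set0.
      by apply/seteqP; split=> // y [A FA _]; apply: F0; exists A.
    by rewrite set0U span_id //; apply: WN.
  move=> Sx; suff [B [FB Bx]] : exists B, F B /\ span (B `|` N) x.
    exact: (Fgood _ FB).
  apply: (Sx [set y | exists B, F B /\ span (B `|` N) y]).
    split=> [|a y z [B [FB By]] [B' [FB' Bz]]].
      by exists A; split=> //; apply: (span_subspace _).1.
    have [BB|BB] := Ftot _ _ FB FB'; [exists B' | exists B]; split=> //;
      apply: (span_subspace _).2 => //.
      by apply: (span_mono _ By); apply: setSU.
    by apply: (span_mono _ Bz); apply: setSU.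
  move=> y [[B FB By]|Ny]; last by exists A; split=> //; apply: sub_span; right.
  by exists B; split=> //; apply: sub_span; left.
pose L := span (M `|` N); have Lsub : subspace L := span_subspace _.
have dec v : exists wv : V, W wv /\ L (v - wv).
  apply: contrapT => nv.
  have nLv : ~ L v by move=> Lv; apply: nv; exists 0; rewrite subr0; split=> //; apply: Wsub.1.
  apply: (Mmax (M `|` [set v])).
    split; first by move=> y; left.
    by move=> /(_ v (or_intror erefl)) Mv; apply: nLv; apply: sub_span; left.
  (* Adding a vector outside W + L to M keeps the intersection with W trivial. *)
  move=> x Wx Sx.
  have [c Lc] : exists c, L (x - c *: v).
    apply: (Sx [set y | exists c, L (y - c *: v)]).
      split=> [|a y z [c Ly] [c' Lz]].
        by exists 0; rewrite scale0r subr0; apply: Lsub.1.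
      exists (a * c + c'); rewrite scalerDl -scalerA opprD addrACA -scalerBr.
      exact: Lsub.2.
    move=> y [[My|->]|Ny].
    - by exists 0; rewrite scale0r subr0; apply: sub_span; left.
    - by exists 1; rewrite scale1r subrr; apply: Lsub.1.
    by exists 0; rewrite scale0r subr0; apply: sub_span; right.
  have [c0|c0] := eqVneq c 0.
    by apply: (Mgood _ Wx); rewrite c0 scale0r subr0 in Lc.
  case: nv; exists (c^-1 *: x); split; first exact: (subspaceZ _ Wsub Wx).
  have -> : v - c^-1 *: x = (- c^-1) *: (x - c *: v).
    by rewrite scalerBr scalerA mulNr mulVf // scaleN1r opprK scaleNr addrC.
  exact: (subspaceZ _ Lsub Lc).
have [P0 P0E] := choice dec.
have Puniq v w : W w -> L (v - w) -> P0 v = w.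
  move=> Ww Lw; have [Wv Lv] := P0E v; apply/eqP; rewrite -subr_eq0; apply/eqP.
  apply: (Mgood _ (subspaceB Wsub Wv Ww)).
  have -> : P0 v - w = (v - w) - (v - P0 v) by rewrite opprB addrCA addrAC subrr add0r addrC.
  exact: (subspaceB Lsub Lw Lv).
have [|P PE] := @linear_pack K V V P0.
  move=> a x y; have [[Wx Lx] [Wy Ly]] := (P0E x, P0E y).
  apply: Puniq; first exact: Wsub.2.
  by rewrite opprD addrACA -scalerBr; apply: Lsub.2.
exists P; split=> [x Wx|]; last split=> [x Nx|x].
- by rewrite PE; apply: Puniq => //; rewrite subrr; apply: Lsub.1.
- rewrite PE; apply: Puniq; first exact: Wsub.1.
  by rewrite subr0; apply: sub_span; right.
by rewrite PE; case: (P0E x).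
Qed.

End Subspaces.

Section TensorSubspaces.
Variables (K : fieldType) (U V U' V' : lmodType K).

Lemma tens_sub_map (f : {linear U -> U'}) (g : {linear V -> V'})
    (X : set U) (Y : set V) (X' : set U') (Y' : set V') t :
  (forall u, X u -> X' (f u)) -> (forall v, Y v -> Y' (g v)) ->
  tens_sub X Y t -> tens_sub X' Y' (tens_map f g t).
Proof.
have [S0 SD] := span_subspace [set t | exists u v, [/\ X' u, Y' v & t = u ⊗ v]].
move=> fX gY Xt; apply: (Xt [set t | tens_sub X' Y' (tens_map f g t)]).
  by split=> [|a x y xt yt]; rewrite /= ?linear0 // linearP; apply: SD.
move=> _ [u [v [Xu Yv ->]]] /=; rewrite tens_mapE; apply: sub_span.
by exists (f u), (g v); split; [apply: fX | apply: gY | ].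
Qed.

Lemma tens_sub_eq (W : lmodType K) (f g : {linear (U ⊗ V)%type -> W})
    (X : set U) (Y : set V) t :
  (forall u v, X u -> Y v -> f (u ⊗ v) = g (u ⊗ v)) ->
  tens_sub X Y t -> f t = g t.
Proof.
move=> fg Xt; apply: (Xt [set t | f t = g t]).
  by split=> [|a x y /= xE yE]; rewrite /= ?linear0 // !linearP xE yE.
by move=> _ [u [v [Xu Yv ->]]]; apply: fg.
Qed.

End TensorSubspaces.

Section GradedPointed.
Variables (K : fieldType) (C : lmodType K) (H : coalgebra C) (G : nat -> set C).
Hypothesis G_sum : forall x, exists m,
  span (\bigcup_(i in [set i | (i < m)%N]) G i) x.
Hypothesis G_sub : forall i, subspace (G i).
Hypothesis G_comul : forall m x, G m x ->
  span (\bigcup_(i in [set i | (i <= m)%N]) tens_sub (G i) (G (m - i)%N)) (comul H x).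
Hypothesis G0 : forall x, G 0 x -> span (grouplike H) x.

Local Notation u := (conv_unit H (scalar_alg K)).

Let conv_tens_sub (f f' g g' : {linear C -> scalar_alg K}) (X Y : set C) x :
  (forall y, X y -> f y = f' y) -> (forall y, Y y -> g y = g' y) ->
  tens_sub X Y (comul H x) -> conv H f g x = conv H f' g' x.
Proof.
move=> fE gE; apply: (tens_sub_eq (f := @mul_map K (scalar_alg K) \o tens_map f g)
  (g := @mul_map K (scalar_alg K) \o tens_map f' g')) => v w Xv Yw /=.
by rewrite !tens_mapE /= fE // gE.
Qed.

(** The m-th convolution power of f vanishes in degrees less than m since every
    term of an iterated comultiplication then has a factor in G 0; on D it is still
    the counit, which is idempotent for convolution. *)
Lemma conv_power_vanish (f : {linear C -> scalar_alg K}) (D : set C) :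
  subcoalgebra H D -> (forall x, G 0 x -> f x = 0) -> (forall x, D x -> f x = u x) ->
  forall m, exists F : {linear C -> scalar_alg K},
    (forall i x, (i < m)%N -> G i x -> F x = 0) /\ (forall x, D x -> F x = u x).
Proof.
move=> [Dsub DD] f0 fD; elim=> [|m [F [F0 FD]]]; first by exists u.
exists (conv H f F); split=> [i x im Gx|x Dx]; last first.
  by rewrite -[RHS](conv1f H u); apply: conv_tens_sub (DD x Dx).
have := G_comul Gx; set B := \bigcup_(_ in _) _ => Bx.
pose L : {linear (C ⊗ C)%type -> scalar_alg K} := @mul_map K (scalar_alg K) \o tens_map f F.
apply: (Bx _ (subspace_ker L)) => t [k /= ki].
apply: (tens_sub_eq (f := L) (g := \0)) => v w Gv Gw.
rewrite /= tens_mapE mul_mapE; case: k ki Gv Gw => [|k] ki Gv Gw.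
  by rewrite f0 // mul0r.
by rewrite (F0 (i - k.+1)%N) ?mulr0 //; lia.
Qed.

(** Let Z be the intersection of D with G 0. With a projection P onto G 0 that
    maps D to Z, the map P ⊗ P fixes the comultiplication of elements of Z and
    sends it to Z ⊗ Z, so Z is a subcoalgebra and equals 0 or D. If Z = 0, the
    functional f = ε(id - P) vanishes on G 0 and is the counit on D, so by its
    convolution powers the counit vanishes on D, and then D = 0. *)
Lemma simple_sub_degree0 (D : set C) : simple_subcoalgebra H D -> D `<=` G 0.
Proof.
move=> [Dsubco D0 Dsimple]; have [Dsub DD] := Dsubco.
pose Z := D `&` G 0; have Zsub : subspace Z by apply: subspaceI.
have [//|Q [QZ [_ QQ]]] :=
  @subspace_projection K C Z [set x | x = 0] Zsub (subspace_ker idfun).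
(* D' is a complement of Z in D; killing it makes P map D to Z. *)
pose D' := D `&` [set x | Q x = 0].
have D'sub : subspace D'.
  by apply: subspaceI => //; apply: subspace_ker.
have [|P [PG [PD _]]] := @subspace_projection K C (G 0) D' (G_sub 0) D'sub.
  by move=> x Gx [Dx /= Qx]; rewrite -Qx QZ.
have PDZ x : D x -> Z (P x).
  move=> Dx; have -> : P x = Q x.
    have := PD (x - Q x); rewrite linearB /= (PG (Q x)); last exact: (QQ x).2.
    move=> /(_ _)/eqP; rewrite subr_eq0 => PQ; apply/eqP/PQ; split=> /=.
      by apply: subspaceB => //; apply: (QQ x).1.
    by rewrite linearB /= (QZ (Q x)) // subrr.
  exact: QQ.
have Zco : subcoalgebra H Z.
  split=> // x [Dx Gx].
  have Gxx : tens_sub (G 0) (G 0) (comul H x).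
    apply: (G_comul Gx); first exact: span_subspace.
    by move=> t [i /=]; rewrite leqn0 => /eqP ->.
  have <- : tens_map P P (comul H x) = comul H x.
    apply: (tens_sub_eq (f := tens_map P P) (g := idfun)) Gxx => v w Gv Gw.
    by rewrite /= tens_mapE !PG.
  exact: tens_sub_map (DD x Dx).
have [Z0|<-] := Dsimple Z Zco (@subIsetl _ _ _); last exact: subIsetr.
case: D0.
pose f : {linear C -> scalar_alg K} := u \o (idfun \- P).
have f0 x : G 0 x -> f x = 0 by move=> Gx; rewrite /f /= PG // subrr linear0.
have fD x : D x -> f x = u x.
  by move=> /PDZ; rewrite Z0 /f /= => ->; rewrite subr0.
have uD0 x : D x -> u x = 0.
  move=> Dx; have [m xm] := G_sum x.
  have [F [F0 FD]] := conv_power_vanish Dsubco f0 fD m.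
  by rewrite -FD //; apply: (xm _ (subspace_ker F)) => y [i /= im]; apply: F0 im.
apply/seteqP; split=> [x Dx /=|_ ->]; last exact: Dsub.1.
rewrite -(counit_left H x); apply: (tens_sub_eq
  (f := @tens_lunit K C \o tens_map (counit H) idfun) (g := \0)) (DD x Dx) => v w Dv Dw.
have := uD0 v Dv; rewrite /conv_unit /= tens_mapE tens_lunitE => v0.
have -> : counit H v = 0 by rewrite -[LHS]mulr1.
by rewrite scale0r.
Qed.

Lemma grouplike_simple x : grouplike H x ->
  simple_subcoalgebra H [set y | exists c : K, y = c *: x].
Proof.
move=> [xx ex]; have lsub : subspace [set y | exists c : K, y = c *: x].
  split=> [|a _ _ [c ->] [c' ->]]; first by exists 0; rewrite scale0r.
  by exists (a * c + c'); rewrite scalerDl scalerA.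
have x0 : x <> 0.
  by move=> x0; move/eqP: ex; rewrite x0 linear0 eq_sym oner_eq0.
split.
- split=> // _ [c ->]; rewrite linearZ /= xx -tensZl; apply: sub_span.
  by exists (c *: x), x; split=> //; [exists c | exists 1; rewrite scale1r].
- by move=> /seteqP[l0 _]; apply/x0/l0; exists 1; rewrite scale1r.
move=> D' [D'sub _] D'l.
have [[c c0 Dc]|nD] := pselect (exists2 c : K, c != 0 & D' (c *: x)); [right|left].
  apply/seteqP; split=> // _ [c' ->]; have := subspaceZ (c' / c) D'sub Dc.
  by rewrite scalerA divfK.
apply/seteqP; split=> [y Dy|_ ->]; last exact: D'sub.1.
have [c yE] := D'l _ Dy; have [c0|c0] := eqVneq c 0; first by rewrite yE c0 scale0r.
by case: nD; exists c => //; rewrite -yE.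
Qed.

Theorem graded_pointed : pointed H.
Proof.
apply/seteqP; split; apply: span_min; try exact: span_subspace.
  by move=> x [D Dsimple Dx]; apply: G0; apply: (simple_sub_degree0 Dsimple).
move=> x gx; apply: sub_span; exists [set y | exists c : K, y = c *: x].
  exact: grouplike_simple.
by exists 1; rewrite scale1r.
Qed.

End GradedPointed.

(** * Homogeneity of the relations *)

Section PolyAlgebra.
Variable K : fieldType.

Fact poly_mul_linearl (y : {poly K}) : linear (fun x : {poly K} => x * y).
Proof. by move=> a x z; rewrite mulrDl scalerAl. Qed.
Fact poly_mul_linearr (x : {poly K}) : linear (fun y : {poly K} => x * y).
Proof. by move=> a y z; rewrite mulrDr scalerAr. Qed.

Definition poly_alg : pzAlgType K :=
  @PzAlg K {poly K} 1 *%R (@mulrA _) (@mul1r _) (@mulr1 _)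
    poly_mul_linearl poly_mul_linearr.

Definition polyX : poly_alg := 'X.

Definition poly_coef (i : nat) (q : poly_alg) : K^o := (q : {poly K})`_i.
Fact poly_coef_linear i : linear (poly_coef i).
Proof. by move=> a x y; rewrite /poly_coef coefD coefZ. Qed.
HB.instance Definition _ i :=
  GRing.isLinear.Build K poly_alg K^o *:%R (poly_coef i) (poly_coef_linear i).

Lemma poly_coefX i k : poly_coef i (polyX ^+ k) = (i == k)%:R.
Proof. exact: coefXn. Qed.

End PolyAlgebra.

(** With h = 0 only g^n = 1 remains; this gives the counit, and the map inverting
    g in degree 0. *)
Lemma relations_h0 (B : pzRingType) (n p j : nat) (d : nat -> nat) (a : B) :
  prime p -> a ^+ n = 1 -> relations n p j d a 0.
Proof.
move=> p_pr an; have p1 := prime_gt1 p_pr.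
have adS k : ad_pow 0 k.+1 a = 0 by rewrite ad_powS mulr0 mul0r subrr.
split=> //.
- case=> [|i] [|k]; rewrite ?adS; last exact: commr0.
  + exact: commr_refl.
  + exact: commr0.
  + exact/commr_sym/commr0.
- by case: (p) p1 => [|[|m]] // _; apply: adS.
- by rewrite expr0n gtn_eqF // prime_gt0.
by case=> // k _; rewrite adS expr0n gtn_eqF // expn_gt0 prime_gt0.
Qed.

Section GradingRelations.
Variables (K : fieldType) (B : pzAlgType K) (a b : B).
Local Notation X := (polyX K).
Local Notation BX := (tens_alg B (poly_alg K)).

Lemma ad_pow_X k :
  ad_pow (b ⊗ X : BX) k (a ⊗ (1 : poly_alg K)) = ad_pow b k a ⊗ (X ^+ k).
Proof.
elim: k => // k IH; rewrite ad_powS IH !(@tensM K B (poly_alg K)).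
by rewrite -exprS -exprSr -tensBl.
Qed.

(** Tensoring h with X multiplies each relation by a power of X: the relations are
    homogeneous. *)
Lemma grading_relations n p j d : relations n p j d a b ->
  relations n p j d (a ⊗ (1 : poly_alg K) : BX) (b ⊗ X).
Proof.
move=> [xC an xp bp xd]; split.
- move=> i k; rewrite !ad_pow_X /GRing.comm !(@tensM K B (poly_alg K)) (xC i k).
  by rewrite -!exprD addnC.
- by rewrite tens_exp an expr1n.
- by rewrite ad_pow_X xp tens0l.
- by rewrite tens_exp bp tens0l.
by move=> k kj; rewrite ad_pow_X tens_exp xd // tens0l.
Qed.

End GradingRelations.

(** * The Hopf algebra structure *)

Section HopfStructure.
Variables (K : fieldType) (n p j : nat) (d : nat -> nat).
Hypothesis charK : p \in [pchar K].
Hypothesis n_gt0 : (0 < n)%N.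
Hypothesis d_mono : forall i k, (1 <= i <= k)%N -> (k <= j)%N -> (d i <= d k)%N.
Let p_pr : prime p. Proof. exact: pcharf_prime charK. Qed.
Local Notation T := (free_alg K).
Local Notation A := (Tbar_n_p_d K n p j d).
Local Notation pi := (@Tbar_n_p_d_pi K n p j d).
Local Notation HT := (free_bialgebra K).
Local Notation rels := (@Tbar_relations K n p j d).
Local Notation piM := (@pi_morph K n p j d).
Local Notation pi_surj := (@Tbar_n_p_d_pi_surj K n p j d).
Local Notation degree := (@Tbar_n_p_d_degree K n p j d).

Lemma Tbar_comul : exists D : {linear A -> (A ⊗ A)%type},
  monoid_morphism (D : A -> tens_alg A A) /\
  forall x, D (pi x) = tens_map pi pi (free_comul x).
Proof.
pose f : {linear T -> tens_alg A A} := tens_map pi pi \o @free_comul K.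
have fM : monoid_morphism f.
  apply: (monoid_morphism_comp _ (free_comul_morph K)).
  exact: (@tens_map_monoid_morphism K T T A A pi pi piM piM).
have [|D [DM DE]] := @Tbar_lift K n p j d (tens_alg A A) f fM; last by exists D.
have -> : f (gT K) = pi (gT K) ⊗ pi (gT K) by rewrite /f /= free_comul_g tens_mapE.
have -> : f (hT K) = (1 : A) ⊗ pi (hT K) + pi (hT K) ⊗ pi (gT K).
  by rewrite /f /= free_comul_h linearD /= !tens_mapE /= piM.1.
exact: (comul_relations (rel_comm rels) charK d_mono rels).
Qed.

Lemma Tbar_counit : exists e : {linear A -> K^o},
  monoid_morphism (e : A -> K) /\ forall x, e (pi x) = free_counit x.
Proof.
pose f : {linear T -> scalar_alg K} := @free_counit K.
have [|e [eM eE]] := @Tbar_lift K n p j d (scalar_alg K) f (free_counit_morph K).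
  have -> : f (gT K) = 1 := free_counit_g K.
  have -> : f (hT K) = 0 := free_counit_h K.
  exact: (relations_h0 _ _ p_pr (expr1n _ n)).
by exists e.
Qed.

Lemma Tbar_bialgebra : exists HA : bialgebra A, bialgebra_morphism HT HA pi.
Proof.
have [D [DM DE]] := Tbar_comul; have [e [eM eE]] := Tbar_counit.
exists (@quotient_bialgebra K T A HT pi pi_surj D DM DE e eM eE); split=> //; exact: piM.
Qed.

(** The algebra map inverting g and killing h: a convolution inverse of the identity
    in degree 0. *)
Lemma Tbar_coinverse0 : exists c : {linear A -> A}, monoid_morphism c /\
  c (pi (gT K)) = pi (gT K) ^+ n.-1.
Proof.
pose f : {linear T -> A} := @free_lift K A (fun x => if x == lg then pi (gT K) ^+ n.-1 else 0).
have fg : f (gT K) = pi (gT K) ^+ n.-1 := free_lift_g _ _.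
have [|c [cM cE]] := @Tbar_lift K n p j d A f (free_lift_monoid_morphism _).
  have -> : f (hT K) = 0 := free_lift_h _ _.
  rewrite fg; apply: relations_h0 => //.
  by rewrite -exprM mulnC exprM (rel_g rels) expr1n.
by exists c; split=> //; rewrite cE.
Qed.

Lemma monomial_deg0 w : count_mem lh w = 0%N -> monomial K w = gT K ^+ size w.
Proof.
elim: w => [|[] w IH] //= w0; first by rewrite monomial0.
by rewrite -cat1s monomialM IH // exprS.
Qed.

Lemma pi_g_inv : pi (gT K) ^+ n.-1 * pi (gT K) = 1.
Proof. by rewrite -exprSr prednK // (rel_g rels). Qed.

Lemma pi_g_invr : pi (gT K) * pi (gT K) ^+ n.-1 = 1.
Proof. by rewrite -exprS prednK // (rel_g rels). Qed.

Definition Tbar_antipode_lift : {linear T -> A} := free_antipode pi (pi (gT K) ^+ n.-1).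
Local Notation s := Tbar_antipode_lift.

Lemma Tbar_hopf : exists H : hopf_algebra A,
  bialgebra_morphism HT H pi /\ forall x, antipode H (pi x) = s x.
Proof.
have [HA piH] := Tbar_bialgebra; have [_ piD pie] := piH.
have [c [cM cg]] := Tbar_coinverse0.
have sL := free_antipode_left piM pi_g_inv.
have sR := free_antipode_right piM pi_g_invr.
have [x|S SE] := @linear_descend K T A A pi s pi_surj.
  apply: (antipode_kernel piH sL (c := c)) => w /monomial_deg0 ->.
  rewrite -[LHS]/(mul_map (tens_map idfun c (comul HA (pi _)))) /conv_unit.
  have e1 m : counit HA (pi (gT K ^+ m)) = 1.
    rewrite pie; apply: (etrans (morph_exp _ _ (free_counit_morph K))).
    by rewrite free_counit_g expr1n.
  rewrite e1 scale1r (morph_exp _ _ piM) (morph_exp _ _ (comul_morph HA)) piD.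
  rewrite [comul _ _]free_comul_g tens_mapE tens_exp tens_mapE mul_mapE /=.
  rewrite (morph_exp _ _ cM) cg -exprMn_comm ?pi_g_invr ?expr1n //.
  exact/commrX/commr_refl.
have [H [HE SH]] := hopf_of_quotient pi_surj piH SE sL sR.
by exists H; rewrite HE SH.
Qed.

(** * The grading, and pointedness *)

(** The coaction of K[X] that gives an element of degree m the weight X^m; its
    coefficients are the projections onto the homogeneous components, so the images
    of the components of the free algebra are in direct sum. *)
Lemma Tbar_coaction : exists r : {linear A -> tens_alg A (poly_alg K)},
  forall w, r (pi (monomial K w)) =
    pi (monomial K w) ⊗ (polyX K ^+ count_mem lh w).
Proof.
pose B := tens_alg A (poly_alg K).
pose f : {linear T -> B} :=
  @free_lift K B (fun x => if x == lg then pi (gT K) ⊗ (1 : poly_alg K)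
                                    else pi (hT K) ⊗ polyX K).
have fM : monoid_morphism f := free_lift_monoid_morphism _.
have fg : f (gT K) = pi (gT K) ⊗ (1 : poly_alg K) := free_lift_g _ _.
have fh : f (hT K) = pi (hT K) ⊗ polyX K := free_lift_h _ _.
have [|r [rM rE]] := @Tbar_lift K n p j d B f fM.
  by rewrite fg fh; apply/grading_relations/rels.
exists r => w; rewrite rE; elim: w => [|c w IH].
  by rewrite monomial0 fM.1 piM.1.
rewrite -cat1s monomialM fM.2 IH piM.2.
case: c; rewrite -?[monomial _ [:: lh]]/(hT K) -?[monomial _ [:: lg]]/(gT K).
  by rewrite fh (@tensM K A (poly_alg K)); congr (_ ⊗ _); rewrite count_cat /= exprS.
by rewrite fg (@tensM K A (poly_alg K)); congr (_ ⊗ _); rewrite count_cat /= mul1r.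
Qed.

Lemma free_degree_eq (V : lmodType K) (f g : {linear T -> V}) m x :
  (forall w, count_mem lh w = m -> f (monomial K w) = g (monomial K w)) ->
  free_degree m x -> f x = g x.
Proof.
move=> fg mx; apply: (mx [set x | f x = g x]) => [|_ [w /= wm <-]]; last exact: fg.
by split=> [|a y z /= yE zE]; rewrite /= ?linear0 // !linearP yE zE.
Qed.

Lemma degree_subspace m : subspace (degree m).
Proof.
have [S0 SD] := span_subspace [set monomial K w | w in [set w | count_mem lh w = m]].
split=> [|a _ _ [x mx <-] [y my <-]]; first by exists 0; rewrite ?linear0.
by exists (a *: x + y); [apply: SD | rewrite linearP].
Qed.

Lemma degree_monomial w : degree (count_mem lh w) (pi (monomial K w)).
Proof. by exists (monomial K w) => //; apply: sub_span; exists w. Qed.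

Lemma degree_projection : exists q : nat -> {linear A -> A},
  (forall m x, degree m (q m x)) /\
  (forall m i x, degree m x -> q i x = if i == m then x else 0).
Proof.
have [r rE] := Tbar_coaction.
have [q qE] : exists q : nat -> {linear A -> A}, forall i w,
    q i (pi (monomial K w)) = if i == count_mem lh w then pi (monomial K w) else 0.
  exists (fun i => @tens_runit K A \o tens_map idfun (@poly_coef K i) \o r) => i w.
  rewrite /= rE tens_mapE tens_runitE /= poly_coefX.
  by case: eqP; rewrite ?scale1r ?scale0r.
exists q; split=> [m x|m i _ [x mx <-]].
  have [{}x ->] := pi_surj x; apply: (monomial_span x (W := [set x | degree m (q m (pi x))])).
    have [D0 DD] := degree_subspace m.
    split=> [|a y z my mz]; first by rewrite /= !linear0.
    by rewrite /= !linearP; apply: DD.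
  move=> _ [w _ <-] /=; rewrite qE; case: eqP => [->|_]; first exact: degree_monomial.
  exact: (degree_subspace m).1.
case: eqP => [->|im].
  apply: (free_degree_eq (f := q m \o pi) (g := pi)) mx => w wm /=.
  by rewrite qE wm eqxx.
apply: (free_degree_eq (f := q i \o pi) (g := \0)) mx => w wm /=.
by rewrite qE wm; case: eqP.
Qed.

Lemma degree_direct_sum : direct_sum_decomposition degree.
Proof.
have [q [qG qE]] := degree_projection; split; first exact: degree_subspace.
  move=> x; have [{}x ->] := pi_surj x; have [m xm] := free_bounded x.
  exists m, (fun i => q i (pi x)); split=> //.
  apply: (xm [set x | pi x = \sum_(i < m) q i (pi x)]) => [|_ [w /= wm <-]].
    split=> [|a y z /= yE zE]; rewrite /= ?linear0.
      by rewrite big1 // => i _; rewrite linear0.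
    rewrite linearP; transitivity (a *: \sum_(i < m) q i (pi y) + \sum_(i < m) q i (pi z)).
      by congr (_ *: _ + _).
    rewrite scaler_sumr -big_split /=.
    by apply: eq_bigr => i _; rewrite !linearP.
  rewrite (bigD1 (Ordinal wm)) //= (qE _ _ _ (degree_monomial w)) eqxx.
  rewrite big1 ?addr0 // => i /negbTE iw.
  by rewrite (qE _ _ _ (degree_monomial w)) -[_ == _]/(i == Ordinal wm) iw.
move=> m f fG f0 i im; have := congr1 (q i) f0.
rewrite linear0 linear_sum (bigD1 (Ordinal im)) //= (qE _ _ _ (fG i)) eqxx.
rewrite big1 ?addr0 // => k /negbTE ki; rewrite (qE _ _ _ (fG k)).
by rewrite eq_sym -[_ == _]/(k == Ordinal im) ki.
Qed.

Lemma degree_mul i k x y : degree i x -> degree k y -> degree (i + k) (x * y).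
Proof.
move=> [{}x xi <-] [{}y yk <-]; have [D0 DD] := degree_subspace (i + k).
apply: (xi [set x | degree (i + k) (pi x * pi y)]) => [|_ [w /= <- <-]].
  split=> [|a u v ui vi]; first by rewrite /= linear0 mul0r.
  by rewrite /= linearP pzmulPl; apply: DD.
apply: (yk [set y | degree (count_mem lh w + k) (pi (monomial K w) * pi y)])
  => [|_ [v /= <- <-]].
  have [E0 ED] := degree_subspace (count_mem lh w + k).
  split=> [|a u v ui vi]; first by rewrite /= linear0 mulr0.
  by rewrite /= linearP pzmulPr; apply: ED.
by rewrite /= -piM.2 -monomialM -count_cat; apply: degree_monomial.
Qed.

Lemma degree0_exp m : degree 0 (pi (gT K) ^+ m).
Proof.
rewrite -(morph_exp _ _ piM); exists (gT K ^+ m) => //; apply: sub_span.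
exists (nseq m lg); first by rewrite /= count_nseq.
by rewrite monomial_deg0 ?count_nseq // size_nseq.
Qed.

Lemma degree1_h : degree 1 (pi (hT K)).
Proof. exact: (degree_monomial [:: lh]). Qed.

Lemma degree_antipode m x : free_degree m x -> degree m (s x).
Proof.
move=> mx; have [D0 DD] := degree_subspace m.
apply: (mx [set x | degree m (s x)]) => [|_ [w /= <- <-]].
  by split=> [|a y z ym zm]; rewrite /= ?linear0 // linearP; apply: DD.
elim: w => [|c w IH].
  by rewrite monomial0 /= free_antipode1 -(expr0 (pi (gT K))); apply: degree0_exp.
rewrite -cat1s monomialM /= free_antipodeM addnC; apply: degree_mul IH _.
case: c; first rewrite -[monomial _ _]/(hT K) free_antipode_h.
  rewrite -mulrN; apply: (@degree_mul 1 0 _ _ degree1_h).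
  by rewrite -scaleN1r; apply: subspaceZ (degree_subspace 0) _; apply: degree0_exp.
by rewrite -[monomial _ _]/(gT K) free_antipode_g; apply: degree0_exp.
Qed.

Lemma degree_comul (H : bialgebra A) m x : bialgebra_morphism HT H pi -> degree m x ->
  span (\bigcup_(i in [set i | (i <= m)%N]) tens_sub (degree i) (degree (m - i)%N))
    (comul H x).
Proof.
move=> [_ piD _] [{}x mx <-]; set W := \bigcup_(_ in _) _; rewrite piD.
have [W0 WD] := span_subspace W.
apply: (mx [set x | span W (tens_map pi pi (free_comul x))]) => [|_ [w /= wm <-]].
  by split=> [|a y z ym zm]; rewrite /= ?linear0 // !linearP; apply: WD.
have td := @comul_tens_degree K w; rewrite wm in td.
apply: (td [set t | span W (tens_map pi pi t)]).
  by split=> [|a y z ym zm]; rewrite /= ?linear0 // linearP; apply: WD.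
move=> _ [u [v [uv ->]]] /=; rewrite tens_mapE; apply: sub_span.
exists (count_mem lh u); first by rewrite /= -uv leq_addr.
apply: sub_span; exists (pi (monomial K u)), (pi (monomial K v)); split=> //.
  exact: degree_monomial.
by rewrite -uv addKn; apply: degree_monomial.
Qed.

Lemma Tbar_graded (H : hopf_algebra A) : bialgebra_morphism HT H pi ->
  (forall x, antipode H (pi x) = s x) -> graded_hopf_algebra H degree.
Proof.
move=> piH SE; split.
- exact: degree_direct_sum.
- exact: (degree0_exp 0).
- exact: degree_mul.
- by move=> m x; apply: degree_comul.
- move=> m x m0 [{}x mx <-]; have [_ _ ->] := piH.
  apply: (free_degree_eq (f := @free_counit K) (g := \0)) mx => w wm /=.
  have : (0 < count_mem lh w)%N by rewrite wm.
  elim: w {wm} => //= c w IH; rewrite -cat1s monomialM (free_counit_morph K).2.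
  case: c => [_|/IH ->]; last by rewrite mulr0.
  by rewrite [free_counit _]free_counit_h mul0r.
by move=> m _ [x mx <-]; rewrite SE; apply: degree_antipode.
Qed.

Lemma degree0_grouplike (H : bialgebra A) x : bialgebra_morphism HT H pi ->
  degree 0 x -> span (grouplike H) x.
Proof.
move=> [_ piD pie] [{}x mx <-]; have [S0 SD] := span_subspace (grouplike H).
apply: (mx [set x | span (grouplike H) (pi x)]) => [|_ [w /= w0 <-]].
  by split=> [|a y z ym zm]; rewrite /= ?linear0 // linearP; apply: SD.
apply: sub_span; rewrite monomial_deg0 //; split.
  transitivity (tens_map pi pi (free_comul (gT K ^+ size w))); first exact: piD.
  by rewrite (morph_exp _ _ (free_comul_morph K)) free_comul_g tens_exp tens_mapE.
rewrite pie; apply: (etrans (morph_exp _ _ (free_counit_morph K))).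
by rewrite free_counit_g expr1n.
Qed.

Lemma Tbar_pointed (H : bialgebra A) : bialgebra_morphism HT H pi -> pointed H.
Proof.
move=> piH; apply: (@graded_pointed K A H degree).
- move=> x; have [_ /(_ x)[m [f [fG ->]]] _] := degree_direct_sum; exists m.
  set S := \bigcup_(_ in _) _; have [S0 SD] := span_subspace S.
  elim/big_ind: _ => // [y z Sy Sz|i _]; first exact: (subspaceD (span_subspace S)).
  by apply: sub_span; exists i => /=.
- exact: degree_subspace.
- by move=> m x; apply: degree_comul.
by move=> x; apply: degree0_grouplike.
Qed.


End HopfStructure.

Theorem proposition3p13 (K : fieldType) (p n j : nat) (d : nat -> nat)
    (charK : p \in [pchar K])
    (n_ge2 : (2 <= n)%N) (p_dvd_n : (p %| n)%N)
    (Egh_neq0 : Tbar_n_pi n (E K (omega 1)) != 0)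
    (j_ge1 : (1 <= j)%N) (j_le : (j <= p - 2)%N)
    (d1_ge1 : (1 <= d 1)%N)
    (d_mono : forall k : nat, (1 <= k < j)%N -> (d k <= d k.+1)%N) :
  exists H : hopf_algebra (Tbar_n_p_d K n p j d),
    [/\ bialgebra_morphism (free_bialgebra K) H (Tbar_n_p_d_pi n p j d),
        graded_hopf_algebra H (@Tbar_n_p_d_degree K n p j d) &
        pointed H].
Proof.
have n0 : (0 < n)%N by apply: leq_trans n_ge2.
have dmono i k : (1 <= i <= k)%N -> (k <= j)%N -> (d i <= d k)%N.
  elim: k => [|k IH] /andP[i1]; first by case: i i1.
  rewrite leq_eqVlt => /predU1P[-> //|ik] kj.
  apply: leq_trans (IH _ (ltnW kj)) (d_mono k _); first by rewrite i1.
  by rewrite kj (leq_trans i1).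
have [H [piH SE]] := Tbar_hopf charK n0 dmono.
by exists H; split=> //; [apply: Tbar_graded | apply: Tbar_pointed].
Qed.
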